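(* For every integer $N\ge 1$ there exists a constant $C=C(N)$ such that for all $p_1\in(1,\infty)$, all $\theta\in(0,1)$ and all $s_1\in(0,1)$ with $s_1p_1\ge 1$, we have $$\left[\frac{u(x)-u(y)}{|x-y|^{\frac{N}{p}+s}}\right]_{M^p(\mathbb{R}^N\times\mathbb{R}^N)}\le C\,|u|_{W^{s_1,p_1}(\mathbb{R}^N)}^{\theta}\,\|\nabla u\|_{L^1(\mathbb{R}^N)}^{1-\theta}\qquad\text{for all }u\in C_c^\infty(\mathbb{R}^N),$$ where $0<s<1$ and $1<p<\infty$ are defined by $$s=\theta s_1+(1-\theta)\qquad\text{and}\qquad\frac1p=\frac{\theta}{p_1}+(1-\theta).$$
   Context: $C_c^\infty(\mathbb{R}^N)$ is the space of real-valued smooth compactly supported functions on $\mathbb{R}^N$. For $1\le p<\infty$ and a measurable function $f$ on $\mathbb{R}^N\times\mathbb{R}^N$, the Marcinkiewicz (weak $L^p$) quasi-norm is defined by $$[f]_{M^p(\mathbb{R}^N\times\mathbb{R}^N)}^p=\sup_{\lambda>0}\lambda^p\,\mathcal{L}^{2N}\bigl(\{(x,y)\in\mathbb{R}^N\times\mathbb{R}^N:\ |f(x,y)|\ge\lambda\}\bigr),$$ where $\mathcal{L}^{2N}$ is Lebesgue measure on $\mathbb{R}^N\times\mathbb{R}^N$. For $0<\sigma<1$ and $1\le r<\infty$ the Gagliardo semi-norm is defined by $$|u|_{W^{\sigma,r}(\mathbb{R}^N)}^r=\iint_{\mathbb{R}^N\times\mathbb{R}^N}\frac{|u(x)-u(y)|^r}{|x-y|^{N+\sigma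 r}}\,dy\,dx.$$ The quotient in the claim is regarded as a function of $(x,y)$, defined for $x\ne y$. *)

(* Defs.v *)
From HB Require Import structures.
From mathcomp Require Import all_boot all_order all_algebra.
From mathcomp Require Import all_classical all_reals all_analysis.

Set Implicit Arguments.
Unset Strict Implicit.
Unset Printing Implicit Defensive.

Import Order.TTheory GRing.Theory Num.Theory.
Import numFieldNormedType.Exports.

Local Open Scope classical_set_scope.
Local Open Scope ring_scope.

(* R^n is 'rV[R]_n, with the sigma-algebra generated by the coordinates,
   i.e. the Borel sigma-algebra. *)
Section measurable_rV.
Context {R : realType} {n : nat}.

Let coors : 'I_n -> 'rV[R]_n -> measurableTypeR R := fun i x => x ord0 i.

Let rV_set0 : g_sigma_preimage coors set0.
Proof. exact: sigma_algebra0. Qed.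

Let rV_setC A : g_sigma_preimage coors A -> g_sigma_preimage coors (~` A).
Proof. exact: sigma_algebraC. Qed.

Let rV_bigcup (F : (set 'rV[R]_n)^nat) :
  (forall i, g_sigma_preimage coors (F i)) ->
  g_sigma_preimage coors (\bigcup_i (F i)).
Proof. exact: sigma_algebra_bigcup. Qed.

HB.instance Definition _ := @isMeasurable.Build default_measure_display
  'rV[R]_n (g_sigma_preimage coors) rV_set0 rV_setC rV_bigcup.

Lemma measurable_coord (i : 'I_n) :
  measurable_fun [set: 'rV[R]_n] (fun x => x ord0 i : measurableTypeR R).
Proof.
move=> _ Y mY; rewrite setTI; apply: sub_sigma_algebra => /=.
rewrite -bigcup_seq/=; exists i => /=; first by rewrite mem_index_enum.
by exists Y => //; rewrite setTI.
Qed.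

Lemma measurable_fun_rVP d (T : measurableType d) (f : T -> 'rV[R]_n) :
  (forall i, measurable_fun [set: T] (fun t => f t ord0 i : measurableTypeR R)) ->
  measurable_fun [set: T] f.
Proof.
move=> mf; suff : g_sigma_preimage (fun i => coors i \o f) `<=` measurable.
  rewrite g_sigma_preimage_comp => prefS _ A mA.
  by rewrite setTI; apply: prefS; exists A => //; rewrite setTI.
apply: smallest_sub; first exact: sigma_algebra_measurable.
rewrite -bigcup_seq; apply: bigcup_sub => i _ A [B mB <-].
exact: (mf i).
Qed.

End measurable_rV.

Section lebesgue_rV.
Context {R : realType}.
Local Open Scope ereal_scope.

Definition rVcons n (x : measurableTypeR R * 'rV[R]_n) : 'rV[R]_n.+1 :=
  \row_j (if unlift ord0 j is Some i then x.2 ord0 i else x.1).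

(* n-dimensional Lebesgue measure: the image of the n-fold product of the
   one-dimensional one. *)
Fixpoint lebesgue_rV n : set 'rV[R]_n -> \bar R :=
  match n with
  | 0%N => \d_(0%R : 'rV[R]_0)
  | k.+1 => pushforward (lebesgue_measure \x @lebesgue_rV k) (@rVcons k)
  end.

Arguments lebesgue_rV n A : clear implicits.

Lemma rVcons0 n x : @rVcons n x ord0 ord0 = x.1.
Proof. by rewrite mxE unlift_none. Qed.

Lemma rVconsS n x i : @rVcons n x ord0 (lift ord0 i) = x.2 ord0 i.
Proof. by rewrite mxE liftK. Qed.

Definition rVuncons n (x : 'rV[R]_n.+1) : measurableTypeR R * 'rV[R]_n :=
  (x ord0 ord0, \row_i x ord0 (lift ord0 i)).

Lemma rVconsK n : cancel (@rVcons n) (@rVuncons n).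
Proof.
move=> [a x]; rewrite /rVuncons rVcons0; congr (_, _).
by apply/rowP => i; rewrite mxE rVconsS.
Qed.

Lemma measurable_rVcons n : measurable_fun setT (@rVcons n).
Proof.
apply: measurable_fun_rVP => j; case: (unliftP ord0 j) => [i ->|->].
  under eq_fun do rewrite rVconsS.
  exact: (measurableT_comp (measurable_coord i) measurable_snd).
under eq_fun do rewrite rVcons0.
exact: measurable_fst.
Qed.

Lemma measurable_rVuncons n : measurable_fun setT (@rVuncons n).
Proof.
apply: measurable_fun_pair; first exact: measurable_coord.
apply: measurable_fun_rVP => i.
under eq_fun do rewrite mxE.
exact: measurable_coord.
Qed.

Section pushforward_rVcons.
Variables (n : nat) (mu : {sigma_finite_measure set 'rV[R]_n -> \bar R}).

Let nu := pushforward (lebesgue_measure \x mu) (@rVcons n).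

Let nu0 : nu set0 = 0.
Proof. by rewrite /nu /pushforward preimage_set0 measure0. Qed.

Let nu_ge0 A : 0 <= nu A.
Proof. by rewrite /nu /pushforward measure_ge0. Qed.

Let nu_sigma_additive : semi_sigma_additive nu.
Proof.
have mrV B : measurable B -> measurable (@rVcons n @^-1` B).
  by move=> mB; rewrite -[X in measurable X]setTI; exact: measurable_rVcons.
move=> F mF tF mUF; rewrite /nu /pushforward preimage_bigcup.
apply: measure_semi_sigma_additive.
- by move=> i; exact: mrV.
- apply/trivIsetP => /= i j _ _ ij; rewrite -preimage_setI.
  by move/trivIsetP : tF => /(_ _ _ _ _ ij) ->//; rewrite preimage_set0.
- by rewrite -preimage_bigcup; exact: mrV.
Qed.

HB.instance Definition _ := isMeasure.Build _ _ _ nu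
  nu0 nu_ge0 nu_sigma_additive.

Let nu_sigma_finite : sigma_finite setT nu.
Proof.
have [F [FT FS Foo]] : exists F : (set (measurableTypeR R * 'rV[R]_n))^nat,
    [/\ setT = \bigcup_i F i, (forall i, measurable (F i)) &
      forall i, (lebesgue_measure \x mu) (F i) < +oo].
  have /sigma_finiteP[F [FT ndF Foo]] := sigma_finiteT (@lebesgue_measure R).
  have /sigma_finiteP[G [GT ndG Goo]] := sigma_finiteT mu.
  exists (fun i => F i `*` G i); split.
  - rewrite -setXTT FT GT predeqE => -[x y]; split.
      move=> [/= [i _ Fix] [k _ Gky]]; exists (maxn i k) => //; split.
      + by move: x Fix; exact/subsetPset/ndF/leq_maxl.
      + by move: y Gky; exact/subsetPset/ndG/leq_maxr.
    by move=> [i _ []/= ? ?]; split; exists i.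
  - by move=> i; apply: measurableX; [case: (Foo i)|case: (Goo i)].
  - move=> i; have [? ?] := Foo i; have [? ?] := Goo i.
    by rewrite product_measure1E// lte_mul_pinfty// ge0_fin_numE.
exists (fun i => @rVuncons n @^-1` F i).
  by rewrite -preimage_bigcup -FT preimage_setT.
move=> i; split.
  by rewrite -[X in measurable X]setTI; apply: measurable_rVuncons.
rewrite /nu /pushforward (_ : _ @^-1` _ = F i)//.
by apply/funext => x; rewrite /preimage/= rVconsK.
Qed.

HB.instance Definition _ := Measure_isSigmaFinite.Build _ _ _ nu
  nu_sigma_finite.

Lemma pushforward_rVcons_sigma_finite :
  exists m : {sigma_finite_measure set 'rV[R]_n.+1 -> \bar R},
  pushforward (lebesgue_measure \x mu) (@rVcons n) = m :> (_ -> _).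
Proof. by exists nu. Qed.

End pushforward_rVcons.

Let lebesgue_rV_sigma_finite_measure n :
  exists mu : {sigma_finite_measure set 'rV[R]_n -> \bar R},
    lebesgue_rV n = mu :> (set 'rV[R]_n -> \bar R).
Proof.
elim: n => [|n [mu muE]].
  by exists (\d_(0%R : 'rV[R]_0)).
have [nu nuE] := pushforward_rVcons_sigma_finite mu.
by exists nu; rewrite /= muE.
Qed.

Let lebesgue_rV0 n : lebesgue_rV n set0 = 0.
Proof. by have [mu ->] := lebesgue_rV_sigma_finite_measure n. Qed.

Let lebesgue_rV_ge0 n A : 0 <= lebesgue_rV n A.
Proof. by have [mu ->] := lebesgue_rV_sigma_finite_measure n. Qed.

Let lebesgue_rV_sigma_additive n : semi_sigma_additive (lebesgue_rV n).
Proof.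
have [mu ->] := lebesgue_rV_sigma_finite_measure n.
exact: measure_semi_sigma_additive.
Qed.

HB.instance Definition _ n := isMeasure.Build _ _ _ (lebesgue_rV n)
  (lebesgue_rV0 n) (lebesgue_rV_ge0 (n := n)) (@lebesgue_rV_sigma_additive n).

Let lebesgue_rV_sigma_finite n : sigma_finite setT (lebesgue_rV n).
Proof.
have [mu ->] := lebesgue_rV_sigma_finite_measure n.
exact: sigma_finiteT.
Qed.

HB.instance Definition _ n := Measure_isSigmaFinite.Build _ _ _
  (lebesgue_rV n) (@lebesgue_rV_sigma_finite n).

(* Characterizes lebesgue_rV among the sigma-finite Borel measures. *)
Lemma lebesgue_rV_box n (A : 'I_n -> set (measurableTypeR R)) :
  (forall i, measurable (A i)) ->
  lebesgue_rV n [set x : 'rV[R]_n | forall i, A i (x ord0 i)] =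
  \prod_(i < n) lebesgue_measure (A i).
Proof.
elim: n A => [|n IHn] A mA.
  rewrite big_ord0 /= diracE mem_set//=.
  by case.
rewrite big_ord_recl -IHn// /= -product_measure1E//; last first.
  rewrite (_ : [set _ | _] = \bigcap_i
      ((fun x : 'rV[R]_n => x ord0 i : measurableTypeR R) @^-1` A (lift ord0 i))).
    apply: fin_bigcap_measurable => // i _.
    by rewrite -[X in measurable X]setTI; apply: measurable_coord.
  by apply/seteqP; split=> x /= Ax i; [move=> _; exact: Ax|exact: (Ax i I)].
congr (product_measure1 _ _ _); apply/seteqP; split => -[a x] /=.
  move=> Ax; split; first by have := Ax ord0; rewrite rVcons0.
  by move=> i; have := Ax (lift ord0 i); rewrite rVconsS.
move=> [/= Aa Ax] j; case: (unliftP ord0 j) => [i ->|->].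
  by rewrite rVconsS; exact: Ax.
by rewrite rVcons0.
Qed.

End lebesgue_rV.
Arguments lebesgue_rV {R} n A.

Section function_spaces.
Context {R : realType} {N : nat}.

(* The norm `|x| of the library on 'rV[R]_N is the sup norm, so the Euclidean
   one is introduced separately. *)
Definition enorm (x : 'rV[R]_N) : R := Num.sqrt (\sum_i x ord0 i ^+ 2).

Definition partial (i : 'I_N) (u : 'rV[R]_N -> R) : 'rV[R]_N -> R :=
  'D_(delta_mx ord0 i) u.

Definition grad (u : 'rV[R]_N -> R) (x : 'rV[R]_N) : 'rV[R]_N :=
  \row_i partial i u x.

(* 'D_v is a total operator, hence the explicit derivability requirement. *)
Definition smooth (u : 'rV[R]_N -> R) : Prop :=
  forall s : seq 'I_N, let du := foldr partial u s in
  continuous du /\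
  forall (i : 'I_N) (x : 'rV[R]_N), derivable du x (delta_mx ord0 i).

Definition Cc_infty (u : 'rV[R]_N -> R) : Prop :=
  smooth u /\ compact (closure [set x | u x != 0]).

Local Open Scope ereal_scope.

(* The integrand takes the value 0 on the diagonal, where both powers vanish
   (inverses of 0 are 0); the diagonal is negligible. *)
Definition gagliardo (sigma r : R) (u : 'rV[R]_N -> R) : \bar R :=
  (\int[lebesgue_rV N \x lebesgue_rV N]_z
     (`|u z.1 - u z.2| `^ r / enorm (z.1 - z.2) `^ (N%:R + sigma * r))%:E)
  `^ r^-1.

End function_spaces.

Section marcinkiewicz.
Context d {T : measurableType d} {R : realType}.
Local Open Scope ereal_scope.

(* A quotient by |x - y|^a, undefined on the diagonal of R^N * R^N, may be
   passed as f: it then takes the value 0 there, so that the diagonal never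
   contributes, as lambda > 0. *)
Definition marcinkiewicz (mu : {measure set T -> \bar R}) (p : R) (f : T -> R)
    : \bar R :=
  (ereal_sup [set (lambda `^ p)%:E * mu [set z | (lambda <= `|f z|)%R]
             | lambda in [set lambda : R | (0 < lambda)%R]])
  `^ p^-1.

End marcinkiewicz.

(* Main.v *)
From HB Require Import structures.
Require Import Defs.
From mathcomp Require Import all_boot all_order all_algebra.
From mathcomp Require Import all_classical all_reals all_analysis.
From mathcomp Require Import measurable_realfun ring lra.

Set Implicit Arguments.
Unset Strict Implicit.
Unset Printing Implicit Defensive.

Import Order.TTheory GRing.Theory Num.Theory.
Import numFieldNormedType.Exports.

(* Since N / p + s = theta (N / p1 + s1) + (1 - theta) (N + 1), the quotient is
   F1 ^ theta * F2 ^ (1 - theta), where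
   F1 = |u(x) - u(y)| / |x - y|^(N / p1 + s1) has the Gagliardo seminorm as its
   L^p1 norm and F2 = |u(x) - u(y)| / |x - y|^(N + 1). By Hoelder's inequality for weak norms,
   everything reduces to the weak L^1 bound [F2] <= C ||grad u||_1.

   To prove it, go from x to y by changing one coordinate at a time; some step
   changes u by at least |u(x) - u(y)| / N. Exchanging the coordinates of x and
   y that have already been changed preserves the measure and turns the step into
   an increment f(a) - f(b) of u along a line parallel to an axis. It remains to
   measure, for a fixed line, the (a, b, w), w being the transverse coordinates
   of the second point, such that |f(a) - f(b)| >= lam r^(N + 1), where r bounds
   |a - b| and the transverse distances. Call a dyadic interval of length l good
   if the variation of f on it is at least k l^(N + 1): then (a, b, w) lies in a
   box of measure O(l^(N + 1)) above some good interval of length comparable to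
   the critical r. As N + 1 > 1, the boxes above all the dyadic subintervals of
   a good interval of length l have total measure O(l^(N + 1)), which is
   controlled by the variation on this interval; so the total is controlled by
   the variation of f on the line, the integral of |f'|. *)

Local Open Scope classical_set_scope.
Local Open Scope ring_scope.

(** * Dyadic intervals on a line *)

(** The least [d] with [l / 2 ^+ d < 2 * r] works: minimality at its predecessor gives the lower
    bound, and for [d = 0] this bound is the assumption [r <= l]. *)
Lemma exists_dyadic_scale {R : realType} (r l : R) : 0 < r -> r <= l ->
  exists d, r <= l / 2 ^+ d < 2 * r.
Proof.
move=> r0 rl.
have ex : exists d, l / 2 ^+ d < 2 * r.
  exists (Num.truncn (l / r)).
  rewrite ltr_pdivrMr ?exprn_gt0//.
  have h : l / r < 2 ^+ Num.truncn (l / r) * 2.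
    apply: (lt_le_trans (truncnS_gt _)).
    rewrite -exprSr -natrX ler_nat; exact/ltnW/ltn_expl.
  by move: h; rewrite ltr_pdivrMr//; lra.
case: (ex_minnP ex) => -[|d] hd hmin.
  by exists 0%N; rewrite hd expr0 divr1 rl.
exists d.+1; rewrite hd andbT leNgt; apply/negP => h.
suff /hmin : l / 2 ^+ d < 2 * r by rewrite ltnn.
move: h; rewrite exprS invfM mulrCA mulrC; lra.
Qed.

(** Points at distance at most [h] lie in the same or in adjacent cells of the grid of mesh [h]. An
    increment of [2 * e] over at most two cells leaves at least [e] on one of them, and this cell
    enlarged by [h] on each side contains both points. *)
Lemma exists_dyadic_increment {R : realType} (G : R -> R) (c h a b e : R) d :
  {homo G : x y / x <= y} -> 0 < h ->
  c <= a < c + 2 ^+ d * h -> c <= b < c + 2 ^+ d * h -> `|a - b| <= h ->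
  2 * e <= `|G a - G b| ->
  exists2 m, (m < 2 ^ d)%N &
    [/\ e <= G (c + m%:R * h + h) - G (c + m%:R * h),
        c + m%:R * h - h <= a <= c + m%:R * h + 2 * h &
        c + m%:R * h - h <= b <= c + m%:R * h + 2 * h].
Proof.
move=> G_homo h0; wlog ab : a b / a <= b.
  move=> wl ha hb hab hG; have [/wl|/ltW/wl] := leP a b; first exact.
  rewrite distrC (distrC (G b)) => /(_ hb ha hab hG)[m m2 [? ? ?]].
  by exists m.
move=> /andP[ca acd] /andP[cb bcd]; rewrite distrC ger0_norm ?subr_ge0// => abh.
rewrite distrC ger0_norm ?subr_ge0 ?G_homo// => hG.
have cell x : c <= x -> x < c + 2 ^+ d * h -> exists2 m, (m < 2 ^ d)%N &
    c + m%:R * h <= x < c + m%:R * h + h.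
  move=> cx xd; have xh0 : 0 <= (x - c) / h.
    by rewrite divr_ge0 ?subr_ge0 ?(ltW h0).
  have /andP[] := truncn_itv xh0; set m := Num.truncn _.
  rewrite ler_pdivlMr// ltr_pdivrMr// -[m.+1]addn1 natrD => m1 m2.
  exists m; last by apply/andP; split; lra.
  rewrite -(ltr_nat R) natrX -(ltr_pM2r h0).
  by apply: (le_lt_trans m1); lra.
have [m md /andP[ma am]] := cell _ ca acd.
have [k kd /andP[kb bk]] := cell _ cb bcd.
have mk : (m <= k)%N.
  rewrite -ltnS -(ltr_nat R) -(ltr_pM2r h0) -[k.+1]addn1 natrD mulrDl mul1r; lra.
have km : (k <= m.+1)%N.
  rewrite -ltnS -(ltr_nat R) -(ltr_pM2r h0) -[m.+2]addn2 natrD mulrDl; lra.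
have [Gm Gk] := (G_homo _ _ ma, G_homo _ _ (ltW bk)).
move: km; rewrite leq_eqVlt => /orP[/eqP kE|].
  have kmE : c + k%:R * h = c + m%:R * h + h.
    by rewrite kE -addn1 natrD mulrDl mul1r addrA.
  rewrite kmE in kb bk Gk.
  have [e1|e1] := leP e (G (c + m%:R * h + h) - G (c + m%:R * h)).
    by exists m => //; split => //; apply/andP; split; lra.
  exists k => //; rewrite kmE; split; first by lra.
    by apply/andP; split; lra.
  by apply/andP; split; lra.
rewrite ltnS => km; have kE : k = m by apply/eqP; rewrite eqn_leq km mk.
subst k; exists m => //; split; last 2 first.
- by apply/andP; split; lra.
- by apply/andP; split; lra.
(* [e] may be negative; the monotonicity of [G] then suffices. *)
have [e1|e1] := leP 0 e; first by lra.
have := G_homo (c + m%:R * h) (c + m%:R * h + h); rewrite lerDl ltW//.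
by move=> /(_ isT); lra.
Qed.

Lemma measurable_rV_box {R : realType} {n : nat}
    (A : 'I_n -> set (measurableTypeR R)) :
  (forall i, measurable (A i)) ->
  measurable [set x : 'rV[R]_n | forall i, A i (x ord0 i)].
Proof.
move=> mA; rewrite (_ : [set _ | _] = \bigcap_i
    ((fun x : 'rV[R]_n => x ord0 i : measurableTypeR R) @^-1` A i)).
  apply: fin_bigcap_measurable => // i _.
  by rewrite -[X in measurable X]setTI; apply: measurable_coord.
by apply/seteqP; split=> x /= Ax i; [move=> _; exact: Ax|exact: (Ax i I)].
Qed.

(* The pair (a, b) of positions on a line, and the n coordinates of the second
   endpoint that are transverse to this line. *)
Definition slice_measure {R : realType} (n : nat)
  : set ((measurableTypeR R * measurableTypeR R) * 'rV[R]_n)%type -> \bar R :=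
  ((lebesgue_measure \x lebesgue_measure) \x lebesgue_rV n)%E.
Arguments slice_measure {R} n A.

HB.instance Definition _ {R : realType} n :=
  Measure.on (@slice_measure R n).

(** * Boxes above good dyadic intervals *)

Section dyadic_boxes.
Context {R : realType} {n : nat}.
Variables (v : 'rV[R]_n) (G : R -> R) (k : R).

Let T := ((measurableTypeR R * measurableTypeR R) * 'rV[R]_n)%type.

(** The margins around [[c, c + l]] are those of [exists_dyadic_increment]. The exponents [n.+2]
    below are N + 1, the ambient dimension being N = n + 1. *)
Definition dyadic_box (c l : R) : set T :=
  ((`[c - l, c + 2 * l]%classic : set (measurableTypeR R)) `*`
   (`[c - l, c + 2 * l]%classic : set (measurableTypeR R))) `*`
  [set w : 'rV[R]_n | forall j, `[v ord0 j - l, v ord0 j + l]%classic (w ord0 j)].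

(** [d] counts the generations of dyadic subintervals, [[c, c + l]] being the first. The recursion
    continues below a good interval, because each point has to be caught at its own scale. *)
Fixpoint good_boxes (c l : R) (d : nat) : set T :=
  if d is d'.+1 then
    (if k * l ^+ n.+2 <= G (c + l) - G c then dyadic_box c l else set0) `|`
    (good_boxes c (l / 2) d' `|` good_boxes (c + l / 2) (l / 2) d')
  else set0.

Lemma measurable_dyadic_box c l : measurable (dyadic_box c l).
Proof.
apply: measurableX; first by apply: measurableX; exact: measurable_itv.
apply: (@measurable_rV_box R n (fun j => `[v ord0 j - l, v ord0 j + l]%classic)).
by move=> j; exact: measurable_itv.
Qed.

Lemma measurable_good_boxes d c l : measurable (good_boxes c l d).
Proof.
elim: d c l => [|d IH] c l /=; first exact: measurable0.
apply: measurableU; last exact: measurableU.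
by case: ifP => _; [exact: measurable_dyadic_box|exact: measurable0].
Qed.

Lemma measure_dyadic_box c l : 0 <= l ->
  slice_measure n (dyadic_box c l) = (9 * 2 ^+ n * l ^+ n.+2)%:E.
Proof.
move=> l0; set I : set (measurableTypeR R) := `[c - l, c + 2 * l]%classic.
have mI : measurable I by exact: measurable_itv.
pose J j : set (measurableTypeR R) := `[v ord0 j - l, v ord0 j + l]%classic.
have mJ j : measurable (J j) by exact: measurable_itv.
rewrite /dyadic_box -/I.
apply: etrans (product_measure1E (lebesgue_measure \x lebesgue_measure)%E
  (lebesgue_rV n) (measurableX mI mI) (measurable_rV_box mJ)) _.
rewrite [X in (X * _)%E](product_measure1E lebesgue_measure lebesgue_measure
  mI mI).
rewrite [X in (_ * X)%E](lebesgue_rV_box mJ).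
have side x y : x <= y -> lebesgue_measure (`[x, y]%classic : set R) = (y - x)%:E.
  move=> xy; rewrite lebesgue_measure_itv/= lte_fin.
  move: xy; rewrite le_eqVlt => /predU1P[->|->]; last by rewrite EFinB.
  by rewrite ltxx subrr.
transitivity ((3 * l)%:E * (3 * l)%:E * \prod_(j < n) (2 * l)%:E)%E.
  congr (_ * _ * _)%E.
  - by rewrite [LHS]side; [congr EFin; ring|lra].
  - by rewrite [LHS]side; [congr EFin; ring|lra].
  - by apply: eq_bigr => j _; rewrite [LHS]side; [congr EFin; ring|lra].
rewrite prodEFin -!EFinM; congr EFin.
by rewrite big_const card_ord iter_mulr_1 exprMn !exprS; ring.
Qed.

(** A geometric series, where an exponent greater than 1 matters: passing to the halves doubles the
    number of boxes but divides each measure by [2 ^+ n.+2], which is at least 4. *)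
Lemma measure_good_boxes_le_scale d c l : 0 <= l ->
  (slice_measure n (good_boxes c l d) <= (2 * (9 * 2 ^+ n * l ^+ n.+2))%:E)%E.
Proof.
have K0 : 0 <= (9 * 2 ^+ n : R) by rewrite mulr_ge0// exprn_ge0.
elim: d c l => [|d IH] c l l0.
  by rewrite measure0 lee_fin mulr_ge0// mulr_ge0// exprn_ge0.
rewrite [good_boxes _ _ _]/=.
apply: (le_trans (measureU2 (slice_measure n) _ _)).
- by case: ifP => _; [exact: measurable_dyadic_box|exact: measurable0].
- by apply: measurableU; exact: measurable_good_boxes.
have l20 : 0 <= l / 2 by lra.
rewrite mulr_natl mulr2n EFinD; apply: leeD.
  case: ifP => _; first by rewrite [leLHS]measure_dyadic_box.
  by rewrite measure0 lee_fin mulr_ge0// exprn_ge0.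
apply: (le_trans (measureU2 (slice_measure n) _ _)); try exact: measurable_good_boxes.
apply: le_trans (leeD (IH _ _ l20) (IH _ _ l20)) _.
rewrite -EFinD lee_fin.
have -> (K X : R) : 2 * (K * X) + 2 * (K * X) = K * (4 * X) by ring.
rewrite ler_wpM2l// exprMn !exprS.
have : 2^-1 ^+ n <= 1 :> R by rewrite exprn_ile1 ?invr_ge0 ?invf_le1 ?ler1n.
have : 0 <= l * (l * l ^+ n) by rewrite !mulr_ge0 ?exprn_ge0.
nra.
Qed.

Hypothesis G_homo : {homo G : x y / x <= y}.
Hypothesis k0 : 0 < k.

(** A stopping argument, uniform in [d]: on a good interval, the scale bound is controlled by the
    increment of [G]; any other interval contributes no box itself, and the increments of [G] over
    its halves add up. *)
Lemma measure_good_boxes_le d c l : 0 <= l ->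
  (slice_measure n (good_boxes c l d) <=
   (2 * (9 * 2 ^+ n) / k * (G (c + l) - G c))%:E)%E.
Proof.
elim: d c l => [|d IH] c l l0.
  rewrite measure0 lee_fin !mulr_ge0 ?exprn_ge0 ?invr_ge0 ?(ltW k0)//.
  by rewrite subr_ge0 G_homo// lerDl.
case: (boolP (k * l ^+ n.+2 <= G (c + l) - G c)) => [good|bad].
  apply: le_trans (measure_good_boxes_le_scale _ _ l0) _.
  rewrite lee_fin -!mulrA ler_wpM2l// ler_wpM2l// ler_wpM2l ?exprn_ge0//.
  by rewrite ler_pdivlMl.
rewrite /= (negbTE bad) set0U.
have l20 : 0 <= l / 2 by lra.
apply: (le_trans (measureU2 (slice_measure n) _ _)); try exact: measurable_good_boxes.
apply: le_trans (leeD (IH _ _ l20) (IH _ _ l20)) _.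
rewrite -EFinD lee_fin -mulrDr (_ : c + l / 2 + l / 2 = c + l); last by field.
by rewrite [X in _ * X](_ : _ = G (c + l) - G c)//; ring.
Qed.

Lemma sub_good_boxes_succ d c l : good_boxes c l d `<=` good_boxes c l d.+1.
Proof.
elim: d c l => [|d IH] c l //.
apply: setUS; apply: setUSS; exact: IH.
Qed.

(** The leading binary digit of [m] selects the half of [[c, c + l]] to descend into. The depth is
    [d.+1] since the intervals of length [l / 2 ^+ d] form generation [d.+1]. *)
Lemma dyadic_box_sub_good_boxes d m c l : (m < 2 ^ d)%N ->
  let h := l / 2 ^+ d in let c' := c + m%:R * h in
  k * h ^+ n.+2 <= G (c' + h) - G c' ->
  dyadic_box c' h `<=` good_boxes c l d.+1.
Proof.
elim: d m c l => [|d IH] m c l.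
  rewrite expn0 ltnS leqn0 => /eqP-> /=.
  by rewrite expr0 divr1 mul0r addr0 => ->; left.
have hE : l / 2 ^+ d.+1 = l / 2 / 2 ^+ d by rewrite exprS invfM mulrA.
move=> md; cbv zeta; rewrite hE.
have [m2|m2] := ltnP m (2 ^ d).
  by move=> /(IH _ _ _ m2) hsub p /hsub ?; right; left.
have md2 : (m - 2 ^ d < 2 ^ d)%N.
  by rewrite ltn_subLR// addnn -mul2n -expnS.
set h := l / 2 / 2 ^+ d.
have -> : c + m%:R * h = c + l / 2 + (m - 2 ^ d)%N%:R * h.
  have hl : 2 ^+ d * h = l / 2 by rewrite /h mulrC divfK// expf_neq0.
  by rewrite natrB// mulrBl natrX hl; ring.
by move=> /(IH _ _ _ md2) hsub p /hsub ?; right; right.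
Qed.

End dyadic_boxes.

Section slice_measure_sigma_finite.
Context {R : realType} (n : nat).

Let slice_measure_sigma_finite : sigma_finite setT (@slice_measure R n).
Proof.
exists (fun k : nat => dyadic_box (0 : 'rV[R]_n) 0 k%:R); last first.
  move=> k; split; first exact: measurable_dyadic_box.
  by rewrite measure_dyadic_box// ltry.
apply/seteqP; split => // -[[a b] w] _.
pose M := (\max_(j < n) (Num.truncn `|w ord0 j|).+1)%N.
exists (maxn M (maxn (Num.truncn `|a|).+1 (Num.truncn `|b|).+1)) => //.
set k := maxn _ _.
have le_k (x : R) : ((Num.truncn `|x|).+1 <= k)%N -> - k%:R <= x <= k%:R.
  move=> xk; rewrite -ler_norml; apply: (le_trans (ltW (truncnS_gt _))).
  by rewrite ler_nat.
have k0 : 0 <= k%:R :> R by [].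
split; first split.
- have /le_k/andP[a1 a2] : ((Num.truncn `|a|).+1 <= k)%N.
    by rewrite /k !leq_max leqnn orbT.
  by rewrite /= in_itv/= !add0r; apply/andP; split; lra.
- have /le_k/andP[b1 b2] : ((Num.truncn `|b|).+1 <= k)%N.
    by rewrite /k !leq_max leqnn !orbT.
  by rewrite /= in_itv/= !add0r; apply/andP; split; lra.
move=> j; rewrite /= in_itv/= mxE !add0r; apply: le_k.
by rewrite /k leq_max (leq_bigmax j).
Qed.

HB.instance Definition _ := Measure_isSigmaFinite.Build _ _ _
  (slice_measure n) slice_measure_sigma_finite.

End slice_measure_sigma_finite.

(** * The measure estimate above a fixed line *)

Lemma measure_le_of_nondecreasing_cover d (T : measurableType d)
    (R : realType) (mu : {measure set T -> \bar R}) (A : set T)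
    (F : (set T)^nat) (b : \bar R) :
  measurable A -> (forall i, measurable (F i)) ->
  (forall i, F i `<=` F i.+1) -> A `<=` \bigcup_i F i ->
  (forall i, mu (F i) <= b)%E -> (mu A <= b)%E.
Proof.
move=> mA mF ndF AF muF.
have mUF : measurable (\bigcup_i F i) by exact: bigcup_measurable.
apply: (@le_trans _ _ (mu (\bigcup_i F i))).
  by apply: le_measure; rewrite ?inE.
have ndF' : {homo F : n m / (n <= m)%N >-> (n <= m)%O}.
  by apply/nondecreasing_seqP => i; apply/subsetPset; exact: ndF.
have muU : mu \o F @ \oo --> mu (\bigcup_i F i) by exact: nondecreasing_cvg_mu.
rewrite -(cvg_lim _ muU)//; apply: lime_le.
  by apply/cvg_ex; eexists; exact: muU.
by apply: nearW => i; exact: muF.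
Qed.

(** The radius [r] with [lam * r ^+ n.+2 = D] bounds the distances along and across the line. For a
    dyadic length [h] in [[r, 2 * r[], the jump [D] makes an interval of length [h] near [a] and [b]
    good, and the box above it contains the point. The bound on the good boxes is uniform in the
    depth, so it survives the limit. *)
Lemma measure_slice_le {R : realType} {n : nat} (v : 'rV[R]_n) (f G : R -> R)
    (lam V : R)
    (A : set ((measurableTypeR R * measurableTypeR R) * 'rV[R]_n)) :
  {homo G : x y / x <= y} -> (forall a b, G b - G a <= V) ->
  (forall a b, `|f a - f b| <= `|G a - G b|) -> 0 < lam -> measurable A ->
  (forall p, A p ->
    let D := `|f p.1.1 - f p.1.2| in
    [/\ 0 < D, lam * `|p.1.1 - p.1.2| ^+ n.+2 <= D &
        forall j, lam * `|v ord0 j - p.2 ord0 j| ^+ n.+2 <= D]) ->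
  (slice_measure n A <=
   ((2 * (9 * 2 ^+ n)) * 2 ^+ n.+3 / lam * V)%:E)%E.
Proof.
move=> G_homo GV fG lam0 mA hA.
pose S (L : nat) : set ((measurableTypeR R * measurableTypeR R) * 'rV[R]_n) :=
  ((`[- L%:R, L%:R[%classic : set (measurableTypeR R)) `*`
   (`[- L%:R, L%:R[%classic : set (measurableTypeR R))) `*` setT.
have mS L : measurable (S L).
  by apply: measurableX => //; apply: measurableX; exact: measurable_itv.
(* Truncating the positions places them all in one root interval to be subdivided. *)
apply: (@measure_le_of_nondecreasing_cover _ _ _ _ _ (fun L => A `&` S L)) => //.
- by move=> L; exact: measurableI.
- move=> L; apply: setIS => p [[/= h1 h2] _]; split=> //.
  have LS : L%:R <= L.+1%:R :> R by rewrite ler_nat.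
  by split; move: h1 h2; rewrite /= !in_itv/= => /andP[? ?] /andP[? ?];
    apply/andP; split; lra.
- move=> p Ap.
  exists (maxn (Num.truncn `|p.1.1|).+1 (Num.truncn `|p.1.2|).+1) => //.
  split => //; split => //; rewrite /S/=.
  have bd (x : R) (m k : nat) : ((Num.truncn `|x|).+1 <= maxn m k)%N ->
      - (maxn m k)%:R <= x < (maxn m k)%:R.
    rewrite -(ler_nat R) => h.
    have /(lt_le_trans (truncnS_gt _)) := h.
    by rewrite ltr_norml => /andP[h1 ->]; rewrite ltW.
  by split; rewrite in_itv/=; apply: bd; rewrite ?leq_maxl ?leq_maxr.
move=> L.
(* A factor [2 ^+ n.+2] pays for [h < 2 * r], and one more factor 2 for keeping only one of two
   adjacent cells. *)
set k := lam / 2 ^+ n.+3.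
have k0 : 0 < k by rewrite divr_gt0// exprn_gt0.
have V0 : 0 <= V by have := GV 0 0; rewrite subrr.
(* The root interval [[- L', L'[] contains the truncated positions and is at least as long as every
   [r] that occurs: [r ^+ n.+2 = D / lam <= V / lam], and adding 1 gives a base no larger than its
   powers. *)
pose L' : R := L%:R + (1 + V / lam).
have Vl0 : 0 <= V / lam by rewrite divr_ge0// ltW.
have L'0 : 0 < L' by rewrite /L' ltr_wpDl//; lra.
pose U d := good_boxes v G k (- L') (2 * L') d.
apply: (@measure_le_of_nondecreasing_cover _ _ _ _ _ U) => //.
- exact: measurableI.
- by move=> i; exact: measurable_good_boxes.
- by move=> i; exact: sub_good_boxes_succ.
- move=> [[a b] w] [/hA[/= D0 hab hw]] [[/= Ia Ib] _].
  move: D0 hab hw; set D := `|f a - f b| => D0 hab hw.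
  pose r := (D / lam) `^ (n.+2%:R)^-1.
  have Dl0 : 0 < D / lam by rewrite divr_gt0.
  have r0 : 0 < r by rewrite powR_gt0.
  have rD : r ^+ n.+2 = D / lam.
    by rewrite -powR_mulrn ?powR_ge0// -powRrM mulVf ?pnatr_eq0// powRr1// ltW.
  have le_r x : 0 <= x -> lam * x ^+ n.+2 <= D -> x <= r.
    by move=> x0; rewrite mulrC -ler_pdivlMr// -rD ler_pXn2r ?nnegrE// ltW.
  have DV : D <= V.
    apply: (le_trans (fG _ _)); have [ab|/ltW ba] := leP a b.
      by rewrite ler0_norm ?subr_le0 ?G_homo// opprB GV.
    by rewrite ger0_norm ?subr_ge0 ?G_homo// GV.
  have rL : r <= 2 * L'.
    apply: (@le_trans _ _ (1 + V / lam)); last first.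
      by rewrite /L'; have : 0 <= L%:R :> R by []; lra.
    rewrite -(@ler_pXn2r _ n.+2) ?nnegrE ?addr_ge0// ?(ltW r0)// rD.
    apply: (@le_trans _ _ (1 + V / lam)).
      by rewrite -[leLHS]add0r lerD// ler_pM2r ?invr_gt0.
    by rewrite exprS ler_peMr ?addr_ge0// exprn_ege1// lerDl.
  have [d /andP[rd dr]] := exists_dyadic_scale r0 rL.
  move: rd dr; set h := _ / _ => rh hr.
  have h0 : 0 < h by exact: lt_le_trans rh.
  have hL : 2 ^+ d * h = 2 * L' by rewrite mulrC /h divfK// expf_neq0.
  have LL : L%:R < L' by rewrite /L' ltrDl; lra.
  have abh : `|a - b| <= h by apply: le_trans rh; exact: le_r.
  have IL x : `[- L%:R, L%:R[%classic x -> - L' <= x < - L' + 2 ^+ d * h.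
    by rewrite /= in_itv/= hL => /andP[x1 x2]; apply/andP; split; lra.
  have e2 : 2 * (k * h ^+ n.+2) <= `|G a - G b|.
    apply: le_trans (fG a b); rewrite -/D.
    have -> : D = lam * r ^+ n.+2 by rewrite rD mulrC divfK// gt_eqF.
    have -> : k = lam / 2 ^+ n.+2 / 2.
      by rewrite /k (exprS 2 n.+2) invfM mulrA mulrAC.
    have Y0 : 2 ^+ n.+2 != 0 :> R by rewrite expf_neq0.
    have -> (X : R) : 2 * (lam / 2 ^+ n.+2 / 2 * X) = lam * (X / 2 ^+ n.+2).
      by move: (2 ^+ n.+2) Y0 => Y Y0; field.
    rewrite ler_pM2l// ler_pdivrMr ?exprn_gt0// mulrC -exprMn.
    by rewrite lerXn2r ?nnegrE ?mulr_ge0// ltW.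
  have [m md [gm am bm]] :=
    exists_dyadic_increment G_homo h0 (IL _ Ia) (IL _ Ib) abh e2.
  exists d.+1 => //.
  apply: (@dyadic_box_sub_good_boxes R n v G k d m (- L') (2 * L') md gm).
  split; first by split; rewrite /= in_itv/=.
  move=> j /=; rewrite in_itv/= -/h.
  have : `|v ord0 j - w ord0 j| <= h.
    by apply: le_trans rh; apply: le_r => //; exact: hw.
  by rewrite ler_norml => /andP[h1 h2]; apply/andP; split; lra.
move=> i; apply: le_trans (measure_good_boxes_le _ _ _ _ _ _) _ => //.
  by rewrite mulr_ge0// ltW.
have -> : 2 * (9 * 2 ^+ n) * 2 ^+ n.+3 / lam = 2 * (9 * 2 ^+ n) / k :> R.
  by rewrite /k invf_div -[LHS]mulrA.
rewrite lee_fin ler_wpM2l// divr_ge0 ?(ltW k0)// mulr_ge0// mulr_ge0.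
Qed.

Lemma le_variation_integral {R : realType} (f : R -> R) (a b : R) :
  a <= b -> (forall x, derivable f x 1) -> continuous (derive1 f) ->
  (`|f b - f a|%:E <=
   \int[lebesgue_measure]_(x in `]a, b]%classic) `|derive1 f x|%:E)%E.
Proof.
rewrite le_eqVlt => /predU1P[->|ab] df cf'.
  by rewrite subrr normr0; apply: integral_ge0.
have cf : continuous f by move=> x; exact/differentiable_continuous/derivable1_diffP.
have mf' : measurable_fun setT (derive1 f : measurableTypeR R -> measurableTypeR R).
  exact: continuous_measurable_fun.
have FTC : (\int[lebesgue_measure]_(x in `[a, b]) (derive1 f x)%:E =
    (f b)%:E - (f a)%:E)%E.
  apply: continuous_FTC2 => //.
    exact: continuous_subspaceT.
  split=> [x _||]; first exact: df.
    exact/cvg_at_right_filter/cf.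
  exact/cvg_at_left_filter/cf.
rewrite -abse_EFin EFinB -FTC integral_itv_obnd_cbnd.
  apply: le_abse_integral; first exact: measurable_itv.
  by apply/measurable_EFinP; exact: measurable_funTS.
apply/measurable_EFinP; apply: measurableT_comp => //.
exact: measurable_funTS.
Qed.

(** The primitive [G] of the absolute value of the derivative dominates the increments of [f], and
    its increments are at most the integral on the right. *)
Lemma measure_slice_le_derive {R : realType} {n : nat} (v : 'rV[R]_n)
    (f : R -> R) (lam : R)
    (A : set ((measurableTypeR R * measurableTypeR R) * 'rV[R]_n)) :
  (forall x, derivable f x 1) -> continuous (derive1 f) -> 0 < lam ->
  measurable A ->
  (forall p, A p ->
    let D := `|f p.1.1 - f p.1.2| in
    [/\ 0 < D, lam * `|p.1.1 - p.1.2| ^+ n.+2 <= D &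
        forall j, lam * `|v ord0 j - p.2 ord0 j| ^+ n.+2 <= D]) ->
  (slice_measure n A <=
   ((2 * (9 * 2 ^+ n)) * 2 ^+ n.+3 / lam)%:E *
     \int[lebesgue_measure]_x `|derive1 f x|%:E)%E.
Proof.
move=> df cf' lam0 mA hA.
have mf' : measurable_fun setT (fun x : measurableTypeR R => `|derive1 f x|%:E).
  apply/measurable_EFinP; apply: measurableT_comp => //.
  exact: continuous_measurable_fun.
set I := (\int[_]_x _)%E.
have I0 : (0 <= I)%E by exact: integral_ge0.
have K0 : 0 < (2 * (9 * 2 ^+ n)) * 2 ^+ n.+3 / lam.
  have X0 m : 0 < 2 ^+ m :> R by rewrite exprn_gt0.
  by apply: divr_gt0 => //; apply: mulr_gt0 => //; do 2 apply: mulr_gt0 => //.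
(* An infinite integral makes the bound trivial; otherwise [fine] is only applied to finite values
   below. *)
have [IE|Ifin] := eqVneq I +oo%E.
  by rewrite IE gt0_muley; [exact: leey|rewrite lte_fin; exact: K0].
have IE : I \is a fin_num by rewrite ge0_fin_numE// ltey.
pose G t :=
  fine (\int[lebesgue_measure]_(x in `]-oo, t]%classic) `|derive1 f x|%:E)%E.
have le_I (D : set (measurableTypeR R)) : measurable D ->
    (\int[lebesgue_measure]_(x in D) `|derive1 f x|%:E <= I)%E.
  by move=> mD; apply: ge0_subset_integral.
have fin_I (D : set (measurableTypeR R)) : measurable D ->
    (\int[lebesgue_measure]_(x in D) `|derive1 f x|%:E)%E \is a fin_num.
  move=> mD; rewrite ge0_fin_numE ?integral_ge0//.
  by apply: (le_lt_trans (le_I _ mD)); rewrite -ge0_fin_numE.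
have GB a b : a <= b ->
    (\int[lebesgue_measure]_(x in `]a, b]%classic) `|derive1 f x|%:E =
     (G b - G a)%:E)%E.
  move=> ab; rewrite EFinB /G !fineK ?fin_I//.
  rewrite (_ : `]-oo, b]%classic = `]-oo, a] `|` `]a, b]); last first.
    by rewrite -itv_bndbnd_setU.
  rewrite ge0_integral_setU//=; last 2 first.
  - exact: measurable_funTS.
  - apply/disj_set2P; rewrite -subset0 => x [].
    by rewrite /= !in_itv/= => xa /andP[/lt_le_trans/(_ xa)]; rewrite ltxx.
  by rewrite addeAC subee ?add0e// fin_I.
have G_homo : {homo G : x y / x <= y}.
  by move=> a b ab; rewrite -subr_ge0 -lee_fin -GB// integral_ge0.
rewrite -(fineK IE) -EFinM.
apply: (@measure_slice_le _ _ v f G) => //.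
- move=> a b; have [ab|/ltW ba] := leP a b.
    by rewrite -lee_fin -GB// fineK// le_I.
  by apply: (@le_trans _ _ 0); rewrite ?subr_le0 ?G_homo// fine_ge0.
- suff h a b : a <= b -> `|f a - f b| <= `|G a - G b|.
    move=> a b; have [/h//|/ltW/h] := leP a b.
    by rewrite distrC (distrC (G b)).
  move=> ab; rewrite distrC (distrC (G a)) [leRHS]ger0_norm ?subr_ge0 ?G_homo//.
  by rewrite -lee_fin -GB//; exact: le_variation_integral.
Qed.

(** * Borel sets and the uniqueness of measures on boxes *)

(** The sigma-algebra is generated by the coordinates, so open sets need an argument: an open set is
    the union of the countably many cubes with rational centres and half-sides [k.+1%:R^-1] that it
    contains. *)
Lemma open_measurable_rV {R : realType} {n : nat} (O : set 'rV[R]_n) :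
  open O -> measurable O.
Proof.
move=> oO.
pose B (q : 'rV[rat]_n * nat) : set 'rV[R]_n :=
  [set y | forall j, (`]ratr (q.1 ord0 j) - q.2.+1%:R^-1,
             ratr (q.1 ord0 j) + q.2.+1%:R^-1[%classic : set (measurableTypeR R))
             (y ord0 j)].
have mB q : measurable (B q).
  apply: (@measurable_rV_box R n (fun j => `]ratr (q.1 ord0 j) - q.2.+1%:R^-1,
    ratr (q.1 ord0 j) + q.2.+1%:R^-1[%classic)).
  by move=> j; exact: measurable_itv.
rewrite (_ : O = \bigcup_(q : 'rV[rat]_n * nat)
    (if `[< B q `<=` O >] then B q else set0)).
  apply: countable_bigcupT_measurable; first exact: countableP.
  by move=> q; case: ifP => _; [exact: mB|exact: measurable0].
apply/seteqP; split=> [x Ox|x [q _]]; last first.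
  by case: asboolP => // BO; exact: BO.
have /nbhs_ballP[e /= e0 xeO] := open_nbhs_nbhs (conj oO Ox).
(* With [2 * del < e], a cube of half-side [del] containing [x] stays in the ball of radius [e]
   about [x] for the sup norm. *)
have [k [del [delE del0 ke]]] : exists k (del : R),
    [/\ del = k.+1%:R^-1, 0 < del & 2 * del < e].
  exists (Num.truncn (2^-1 * e)^-1); eexists; split; first by [].
    by rewrite invr_gt0.
  rewrite -ltr_pdivlMl// invf_plt ?posrE ?(mulr_gt0 _ e0)//.
  exact: truncnS_gt.
have /choice[q hq] (j : 'I_n) : exists q : rat,
    ratr q \in `](x ord0 j - del), (x ord0 j + del)[.
  by apply: rat_in_itvoo; lra.
exists (\row_j q j, k) => //.
have -> : `[< B (\row_j q j, k) `<=` O >].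
  apply/asboolP => y By; apply: xeO; split=> // i j; rewrite (ord1 i).
  have := By j; have := hq j.
  rewrite /= -delE mxE !in_itv/= => /andP[? ?] /andP[? ?].
  by rewrite /ball/= ltr_norml; apply/andP; split; lra.
move=> j; have := hq j; rewrite /= -delE mxE !in_itv/= => /andP[? ?].
by apply/andP; split; lra.
Qed.

Lemma continuous_measurable_fun_rV {R : realType} {n : nat} (f : 'rV[R]_n -> R) :
  continuous f -> measurable_fun setT (f : 'rV[R]_n -> measurableTypeR R).
Proof.
move=> /continuousP cf; apply: (measurability _ (RGenOpens.measurableE R)).
move=> _ [_ [a [b ->] <-]]; rewrite setTI; apply: open_measurable_rV.
exact/cf/interval_open.
Qed.

Section box_unique.
Context {R : realType} {I : finType}.

(** Arbitrary coordinate maps cover both row vectors and pairs of row vectors, the latter with a sum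
    type as index. *)
Definition boxes (T : Type) (c : I -> T -> R) : set (set T) :=
  [set X | exists2 A : I -> set (measurableTypeR R),
     (forall i, measurable (A i)) & X = [set t | forall i, A i (c i t)]].

Lemma setI_closed_boxes T (c : I -> T -> R) : setI_closed (boxes c).
Proof.
move=> _ _ [A mA ->] [B mB ->]; exists (fun i => A i `&` B i).
  by move=> i; exact: measurableI.
apply/seteqP; split => t /=; first by move=> [? ?] i; split.
by move=> h; split=> i; case: (h i).
Qed.

(** Boxes are stable under intersection and generate the sigma-algebra, and cubes of finite measure
    exhaust the space. The second hypothesis expresses that the coordinates generate the
    sigma-algebra of [T]. *)
Lemma measure_box_unique d (T : measurableType d)
    (c : I -> T -> measurableTypeR R) (m1 m2 : {measure set T -> \bar R}) :
  (forall i, measurable_fun setT (c i)) ->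
  (forall d' (S : measurableType d') (f : S -> T),
     (forall i, measurable_fun setT (c i \o f)) -> measurable_fun setT f) ->
  (forall A : I -> set (measurableTypeR R), (forall i, measurable (A i)) ->
     m1 [set t | forall i, A i (c i t)] = m2 [set t | forall i, A i (c i t)]) ->
  (forall k : nat,
     m1 [set t | forall i, `[- k%:R, k%:R]%classic (c i t)] < +oo%E)%O ->
  forall A, measurable A -> m1 A = m2 A.
Proof.
move=> mc c_gen m12 m1oo A mA.
apply: (measure_unique (boxes c)
  (fun k => [set t | forall i, `[- k%:R, k%:R]%classic (c i t)])) => //.
- apply/seteqP; split; last first.
    apply: smallest_sub; first exact: sigma_algebra_measurable.
    move=> _ [B mB ->].
    rewrite (_ : [set _ | _] = \bigcap_i (c i @^-1` B i)).
      apply: fin_bigcap_measurable => // i _.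
      by rewrite -[X in measurable X]setTI; exact: mc.
    apply/seteqP; split=> x /= Ax i; first by move=> _; exact: Ax.
    exact: (Ax i Logic.I).
  (* Measurability of this identity says that every measurable set of [T] belongs to the
     sigma-algebra generated by the boxes. *)
  have : measurable_fun setT (id : g_sigma_algebraType (boxes c) -> T).
    apply: c_gen => i _ Y mY; rewrite setTI; apply: sub_sigma_algebra.
    exists (fun j => if j == i then Y else setT).
      by move=> j; case: ifP.
    apply/seteqP; split=> t /=; first by move=> Yt j; case: eqP => [->|].
    by move/(_ i); rewrite eqxx.
  by move=> h X mX; have := h measurableT X mX; rewrite setTI.
- exact: setI_closed_boxes.
- by move=> k; exists (fun=> `[- k%:R, k%:R]%classic) => // i; exact: measurable_itv.
- apply/seteqP; split=> // t _.
  exists (\max_i (Num.truncn `|c i t|).+1)%N => // i /=.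
  have h : `|c i t| <= (\max_i (Num.truncn `|c i t|).+1)%:R.
    apply: (le_trans (ltW (truncnS_gt _))); rewrite ler_nat.
    exact: (leq_bigmax i).
  by move: h; rewrite ler_norml in_itv/=.
- by move=> _ [B mB ->]; exact: m12.
Qed.

End box_unique.

(** * Splitting off a coordinate *)

(** Uniqueness applied to the image of [nu] under [phi]: a change of variables has to be checked on
    boxes only. *)
Lemma measure_preimage_box_unique {R : realType} {I : finType}
    d (T : measurableType d) d' (S : measurableType d')
    (c : I -> T -> measurableTypeR R) (phi : S -> T)
    (mu : {measure set T -> \bar R}) (nu : {measure set S -> \bar R}) :
  (forall i, measurable_fun setT (c i)) ->
  (forall d' (S : measurableType d') (f : S -> T),
     (forall i, measurable_fun setT (c i \o f)) -> measurable_fun setT f) ->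
  measurable_fun setT phi ->
  (forall A : I -> set (measurableTypeR R), (forall i, measurable (A i)) ->
     mu [set t | forall i, A i (c i t)] =
     nu [set s | forall i, A i (c i (phi s))]) ->
  (forall k : nat,
     mu [set t | forall i, `[- k%:R, k%:R]%classic (c i t)] < +oo%E)%O ->
  forall A, measurable A -> mu A = nu (phi @^-1` A).
Proof.
move=> mc c_gen mphi munu muoo A mA.
have [m2 m2E] : exists m2 : {measure set T -> \bar R},
    m2 = pushforward nu phi :> (set T -> \bar R).
  by exists (measure_function_pushforward__canonical__measure_function_Measure nu mphi).
rewrite -[RHS]/(pushforward nu phi A) -m2E.
apply: (measure_box_unique mc c_gen) => // B mB.
by rewrite m2E munu.
Qed.

Lemma lebesgue_rV_cube_lty {R : realType} m (k : nat) :
  (@lebesgue_rV R m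
     [set x : 'rV[R]_m | forall i, `[- k%:R, k%:R]%classic (x ord0 i)] < +oo%E)%O.
Proof.
rewrite (@lebesgue_rV_box R m (fun=> `[- k%:R, k%:R]%classic)).
  rewrite lebesgue_measure_itv/=; case: ifP => _; last first.
    by rewrite prodEFin ltry.
  by rewrite -EFinB prodEFin ltry.
by move=> i; exact: measurable_itv.
Qed.

Section insert.
Context {R : realType} {n : nat}.
Implicit Types (i : 'I_n.+1) (t : R) (v : 'rV[R]_n).

Definition insert i t v : 'rV[R]_n.+1 :=
  \row_j (if unlift i j is Some k then v ord0 k else t).

Lemma insert_at i t v : insert i t v ord0 i = t.
Proof. by rewrite mxE unlift_none. Qed.

Lemma insert_lift i t v k : insert i t v ord0 (lift i k) = v ord0 k.
Proof. by rewrite mxE liftK. Qed.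

Lemma measurable_insert i d (S : measurableType d) (t : S -> measurableTypeR R)
    (v : S -> 'rV[R]_n) :
  measurable_fun setT t -> measurable_fun setT v ->
  measurable_fun setT (fun s => insert i (t s) (v s)).
Proof.
move=> mt mv; apply: measurable_fun_rVP => j.
case: (unliftP i j) => [k ->|->].
  under eq_fun do rewrite insert_lift.
  exact: (measurableT_comp (measurable_coord k) mv).
by under eq_fun do rewrite insert_at.
Qed.

(** The definition of [lebesgue_rV] splits off the first coordinate; for an arbitrary one, both
    measures give a box the product of the measures of its sides. *)
Lemma lebesgue_rV_insert i (A : set 'rV[R]_n.+1) : measurable A ->
  lebesgue_rV n.+1 A =
  (lebesgue_rV n \x lebesgue_measure)%E
    ((fun p => insert i p.2 p.1) @^-1` A).
Proof.
apply: (@measure_preimage_box_unique R 'I_n.+1 _ _ _ _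
  (fun j (x : 'rV[R]_n.+1) => x ord0 j)) => //.
- exact: measurable_coord.
- by move=> d' S f mf; exact: measurable_fun_rVP.
- exact: measurable_insert.
- move=> B mB; apply: etrans (lebesgue_rV_box mB) _.
  have mB' j : measurable (B (lift i j)) by exact: mB.
  rewrite (bigD1_ord i)//= muleC -(lebesgue_rV_box mB').
  rewrite -(product_measure1E _ lebesgue_measure (measurable_rV_box mB') (mB i)).
  congr (product_measure1 _ _ _); apply/seteqP; split => -[v t] /=.
    move=> [Bv Bt] j; case: (unliftP i j) => [k ->|->].
      by rewrite insert_lift; exact: Bv.
    by rewrite insert_at.
  move=> h; split; last by have := h i; rewrite insert_at.
  by move=> k; have := h (lift i k); rewrite insert_lift.
- by move=> k; exact: lebesgue_rV_cube_lty.
Qed.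

End insert.

(** When [P] selects an initial segment of the coordinates, this is a point of the path from [w] to
    [v] that changes one coordinate at a time. *)
Definition mix {R : realType} {n : nat} (P : pred 'I_n) (v w : 'rV[R]_n)
    : 'rV[R]_n :=
  \row_k (if P k then v ord0 k else w ord0 k).

Lemma measurable_mix {R : realType} {n : nat} (P : pred 'I_n)
    d (S : measurableType d) (v w : S -> 'rV[R]_n) :
  measurable_fun setT v -> measurable_fun setT w ->
  measurable_fun setT (fun s => mix P (v s) (w s)).
Proof.
move=> mv mw; apply: measurable_fun_rVP => k; rewrite /mix.
under eq_fun do rewrite mxE.
by case: (P k); exact: (measurableT_comp (measurable_coord k)).
Qed.

Section insert_pair.
Context {R : realType} {n : nat}.
Implicit Types (i : 'I_n.+1) (v w : 'rV[R]_n).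

(* The coordinates before i are exchanged between the two points, so that the
   i-th step of the path from x to y runs on the line through v, which does not
   depend on w (see mix_insert_pair). *)
Definition insert_pair i (p : 'rV[R]_n *
    ((measurableTypeR R * measurableTypeR R) * 'rV[R]_n)) :
    'rV[R]_n.+1 * 'rV[R]_n.+1 :=
  let P k := (lift i k < i)%N in
  (insert i p.2.1.1 (mix P p.2.2 p.1), insert i p.2.1.2 (mix P p.1 p.2.2)).

Lemma measurable_insert_pair i : measurable_fun setT (insert_pair i).
Proof.
have m1 : measurable_fun setT (fun p : 'rV[R]_n *
    ((measurableTypeR R * measurableTypeR R) * 'rV[R]_n) => p.2.1).
  by apply: measurableT_comp.
have m2 : measurable_fun setT (fun p : 'rV[R]_n *
    ((measurableTypeR R * measurableTypeR R) * 'rV[R]_n) => p.2.2).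
  by apply: measurableT_comp.
apply: measurable_fun_pair; apply: measurable_insert; try exact: measurable_mix.
- by apply: measurableT_comp.
- by apply: measurableT_comp.
Qed.

(** Before [i] the mixture reads [y], after [i] it reads [x]; the exchange has placed the
    coordinates of [v] in both positions. *)
Lemma mix_insert_pair i v a b w :
  let: (x, y) := insert_pair i (v, ((a, b), w)) in
  mix (fun j : 'I_n.+1 => (j < i)%N) y x = insert i a v /\
  mix (fun j : 'I_n.+1 => (j <= i)%N) y x = insert i b v.
Proof.
split; apply/rowP => j; rewrite !mxE/=.
  case: (unliftP i j) => [k ->|->]; last by rewrite ltnn.
  by rewrite !mxE/=; case: ifP => ->.
case: (unliftP i j) => [k ->|->]; last by rewrite leqnn.
by rewrite !mxE/= leq_eqVlt eq_sym (negbTE (neq_bump _ _))/=; case: ifP => ->.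
Qed.

(** The preimage of a box is a box with the same sides in another order. *)
Lemma lebesgue_rV_insert_pair i (A : set ('rV[R]_n.+1 * 'rV[R]_n.+1)) :
  measurable A ->
  (lebesgue_rV n.+1 \x lebesgue_rV n.+1)%E A =
  (lebesgue_rV n \x slice_measure n)%E
    (insert_pair i @^-1` A).
Proof.
pose c (j : 'I_n.+1 + 'I_n.+1) (z : 'rV[R]_n.+1 * 'rV[R]_n.+1) :
    measurableTypeR R :=
  match j with inl j => z.1 ord0 j | inr j => z.2 ord0 j end.
have boxE (B : 'I_n.+1 + 'I_n.+1 -> set (measurableTypeR R)) :
  [set z | forall j, B j (c j z)] =
    [set x : 'rV[R]_n.+1 | forall j, B (inl j) (x ord0 j)] `*`
    [set x : 'rV[R]_n.+1 | forall j, B (inr j) (x ord0 j)].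
  apply/seteqP; split => -[x y] /=.
    by move=> h; split => j; [exact: (h (inl j))|exact: (h (inr j))].
  by move=> [h1 h2] [j|j]; [exact: h1|exact: h2].
apply: (@measure_preimage_box_unique R _ _ _ _ _ c (insert_pair i)
  (@lebesgue_rV R n.+1 \x @lebesgue_rV R n.+1)%E (@lebesgue_rV R n \x
   @slice_measure R n)%E).
- case=> j.
    exact: (measurableT_comp (measurable_coord j) measurable_fst).
  exact: (measurableT_comp (measurable_coord j) measurable_snd).
- move=> d S f mf.
  have -> : f = (fun s => ((f s).1, (f s).2)) by apply/funext => s; case: (f s).
  apply: measurable_fun_pair; apply: measurable_fun_rVP => j.
    exact: (mf (inl j)).
  exact: (mf (inr j)).
- exact: measurable_insert_pair.
- move=> B mB; rewrite boxE.
  have mB1 j : measurable (B (inl j)) by exact: mB.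
  have mB2 j : measurable (B (inr j)) by exact: mB.
  apply: etrans (product_measure1E (lebesgue_rV n.+1) (lebesgue_rV n.+1)
    (measurable_rV_box mB1) (measurable_rV_box mB2)) _.
  rewrite [X in (X * _)%E](lebesgue_rV_box mB1).
  rewrite [X in (_ * X)%E](lebesgue_rV_box mB2).
  (* [V] and [W] are the sides of the box that constrain [v] and [w] after the exchange. *)
  pose V k := if (lift i k < i)%N then B (inr (lift i k)) else B (inl (lift i k)).
  pose W k := if (lift i k < i)%N then B (inl (lift i k)) else B (inr (lift i k)).
  have mV k : measurable (V k) by rewrite /V; case: ifP.
  have mW k : measurable (W k) by rewrite /W; case: ifP.
  transitivity ((lebesgue_rV n \x slice_measure n)%E
    ([set x : 'rV[R]_n | forall k, V k (x ord0 k)] `*`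
     ((B (inl i) `*` B (inr i)) `*`
      [set x : 'rV[R]_n | forall k, W k (x ord0 k)]))); last first.
    congr (product_measure1 _ _ _); apply/seteqP; split => -[v [[a b] w]] /=.
      move=> [Vv [[Ba Bb] Ww]] [j|j] /=; rewrite mxE;
        case: unliftP => [k ->|->//]; rewrite mxE; have := Vv k; have := Ww k;
        by rewrite /V /W; case: ifP.
    move=> h; split; last (split; first split).
    + move=> k; have /= := h (inl (lift i k)); have /= := h (inr (lift i k)).
      by rewrite !insert_lift !mxE /V; case: ifP.
    + by have /= := h (inl i); rewrite insert_at.
    + by have /= := h (inr i); rewrite insert_at.
    + move=> k; have /= := h (inl (lift i k)); have /= := h (inr (lift i k)).
      by rewrite !insert_lift !mxE /W; case: ifP.
  have mab : measurable (B (inl i) `*` B (inr i)) by exact: measurableX.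
  rewrite [RHS](product_measure1E (lebesgue_rV n) (slice_measure n)
    (measurable_rV_box mV) (measurableX mab (measurable_rV_box mW))).
  rewrite [X in _ = (_ * X)%E](product_measure1E
    (lebesgue_measure \x lebesgue_measure)%E (lebesgue_rV n) mab (measurable_rV_box mW)).
  rewrite [X in _ = (_ * (X * _))%E](product_measure1E lebesgue_measure
    lebesgue_measure (mB1 i) (mB2 i)).
  rewrite [X in _ = (X * _)%E](lebesgue_rV_box mV).
  rewrite [X in _ = (_ * (_ * X))%E](lebesgue_rV_box mW).
  rewrite [X in (X * _)%E = _](bigD1_ord i)//= [X in (_ * X)%E = _](bigD1_ord i)//=.
  rewrite muleACA [RHS]muleCA; congr (_ * _)%E.
  rewrite -!big_split/=; apply: eq_bigr => k _; rewrite /V /W; case: ifP => //.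
  by rewrite muleC.
- move=> k; rewrite (boxE (fun=> `[- k%:R, k%:R]%classic)).
  have mI (j : 'I_n.+1) : measurable (`[- k%:R, k%:R]%classic : set (measurableTypeR R)).
    exact: measurable_itv.
  rewrite [ltLHS](product_measure1E (lebesgue_rV n.+1) (lebesgue_rV n.+1)
    (measurable_rV_box mI) (measurable_rV_box mI)).
  by rewrite lte_mul_pinfty ?ge0_fin_numE//; exact: lebesgue_rV_cube_lty.
Qed.

End insert_pair.

(** * Measurability of comparisons and the Euclidean norm *)

Lemma measurable_set_ler d (T : measurableType d) (R : realType) (f g : T -> R) :
  measurable_fun setT f -> measurable_fun setT g ->
  measurable [set x | f x <= g x].
Proof.
move=> mf mg; have mtrue : measurable [set true] by [].
by have := measurable_fun_ler mf mg measurableT mtrue; rewrite setTI.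
Qed.

Lemma measurable_set_ltr d (T : measurableType d) (R : realType) (f g : T -> R) :
  measurable_fun setT f -> measurable_fun setT g ->
  measurable [set x | f x < g x].
Proof.
move=> mf mg; have mtrue : measurable [set true] by [].
by have := measurable_fun_ltr mf mg measurableT mtrue; rewrite setTI.
Qed.

Section enorm.
Context {R : realType} {n : nat}.

Lemma enorm_ge0 (x : 'rV[R]_n) : 0 <= enorm x.
Proof. exact: sqrtr_ge0. Qed.

Lemma normr_coord_le_enorm (x : 'rV[R]_n) j : `|x ord0 j| <= enorm x.
Proof.
rewrite -sqrtr_sqr ler_sqrt; last by apply: sumr_ge0 => i _; exact: sqr_ge0.
by rewrite (bigD1 j)//= lerDl sumr_ge0// => i _; exact: sqr_ge0.
Qed.

Lemma measurable_enorm d (T : measurableType d) (f : T -> 'rV[R]_n) :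
  (forall i, measurable_fun setT (fun t => f t ord0 i)) ->
  measurable_fun setT (fun t => enorm (f t)).
Proof.
move=> mf; rewrite /enorm; have msqrt : measurable_fun setT (Num.sqrt : R -> R).
  by apply: continuous_measurable_fun; exact: sqrt_continuous.
apply: (measurableT_comp msqrt).
by apply: measurable_sum => i; apply: measurable_funX; exact: mf.
Qed.

Lemma measurable_enorm_sub :
  measurable_fun setT (fun z : 'rV[R]_n * 'rV[R]_n => enorm (z.1 - z.2)).
Proof.
apply: measurable_enorm => i; under eq_fun do rewrite !mxE.
apply: measurable_funB.
  exact: (measurableT_comp (measurable_coord i) measurable_fst).
exact: (measurableT_comp (measurable_coord i) measurable_snd).
Qed.

End enorm.

(** * Restriction to a line parallel to an axis *)

Section coordinate_line.
Context {R : realType} {n : nat}.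
Variables (i : 'I_n.+1) (v : 'rV[R]_n).

Lemma insertD t h : insert i (h + t) v = h *: delta_mx ord0 i + insert i t v.
Proof.
apply/rowP => j; case: (unliftP i j) => [k ->|->].
  rewrite insert_lift [RHS]mxE insert_lift !mxE eqxx/=.
  by rewrite eq_sym (negbTE (neq_lift i k)) mulr0 add0r.
by rewrite insert_at [RHS]mxE insert_at !mxE !eqxx mulr1.
Qed.

Lemma continuous_insert : continuous (fun t : R => insert i t v).
Proof.
move=> t; rewrite (_ : (fun _ => _) =
    (fun t : R => t *: (delta_mx ord0 i : 'rV[R]_n.+1) + insert i 0 v)).
  by apply: cvgD; [exact: scalel_continuous|exact: cvg_cst].
by apply/funext => s; rewrite -insertD addr0.
Qed.

Variable u : 'rV[R]_n.+1 -> R.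

(** The two difference quotients coincide as functions of [h], so derivability and the derivative
    transfer with no limit to compute. *)
Let quotientE t :
  (fun h : R => h^-1 *: (((fun t => u (insert i t v)) \o shift t) (h *: 1) -
     u (insert i t v))) =
  (fun h : R => h^-1 *: ((u \o shift (insert i t v)) (h *: delta_mx ord0 i) -
     u (insert i t v))).
Proof.
by apply/funext => h; rewrite /= insertD [h *: 1]mulr1.
Qed.

Lemma derivable_insert t : derivable u (insert i t v) (delta_mx ord0 i) ->
  derivable (fun t => u (insert i t v)) t 1.
Proof. by rewrite /derivable quotientE. Qed.

Lemma derive1_insert t :
  derive1 (fun t => u (insert i t v)) t = partial i u (insert i t v).
Proof. by rewrite derive1E /derive quotientE. Qed.

End coordinate_line.

(** * The weak type estimate for the gradient *)

Section weak_type_gradient.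
Context {R : realType} {n : nat}.
Variable u : 'rV[R]_n.+1 -> R.
Hypothesis cu : continuous u.
Hypothesis du : forall i x, derivable u x (delta_mx ord0 i).
Hypothesis cdu : forall i, continuous (partial i u).

Let N := n.+1.
Let mu := (@lebesgue_rV R N \x @lebesgue_rV R N)%E.

Let step (i : 'I_N) (z : 'rV[R]_N * 'rV[R]_N) : R :=
  `|u (mix (fun j : 'I_N => (j < i)%N) z.2 z.1) -
    u (mix (fun j : 'I_N => (j <= i)%N) z.2 z.1)|.

(** The strict condition excludes in particular the diagonal, where the other inequality reads
    [0 <= 0]. *)
Let jump (lam : R) (i : 'I_N) : set ('rV[R]_N * 'rV[R]_N) :=
  [set z | 0 < step i z] `&` [set z | lam * enorm (z.1 - z.2) ^+ N.+1 <= step i z].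

(** A telescoping sum along the path from [x] to [y]: its [N] steps cannot all be smaller than this
    average. *)
Let exists_step (x y : 'rV[R]_N) : exists i, `|u x - u y| / N%:R <= step i (x, y).
Proof.
apply: contrapT => /forallNP noi.
have lt_step i : step i (x, y) < `|u x - u y| / N%:R.
  by rewrite ltNge; apply/negP; exact: noi.
pose g (k : nat) := u (mix (fun j : 'I_N => (j < k)%N) y x).
have gE : u x - u y = \sum_(i < N) (g i - g i.+1).
  rewrite -(big_mkord xpredT (fun i => g i - g i.+1)).
  under eq_bigr do rewrite -opprB.
  rewrite sumrN telescope_sumr// opprB /g; congr (u _ - u _).
    by apply/rowP => j; rewrite mxE ltn0.
  by apply/rowP => j; rewrite mxE ltn_ord.
suff : `|u x - u y| < `|u x - u y| by rewrite ltxx.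
rewrite {1}gE; apply: (le_lt_trans (ler_norm_sum _ _ _)).
apply: (@lt_le_trans _ _ (\sum_(i < N) (`|u x - u y| / N%:R))).
  apply: ltr_sum; last by move=> i _; exact: lt_step.
  by apply/hasP; exists ord0; rewrite ?mem_index_enum.
by rewrite sumr_const card_ord -[leLHS]mulr_natr divfK// pnatr_eq0.
Qed.

Let measurable_step i : measurable_fun setT (step i).
Proof.
have mu_ P : measurable_fun setT (fun z : 'rV[R]_N * 'rV[R]_N => u (mix P z.2 z.1)).
  apply: (measurableT_comp (continuous_measurable_fun_rV cu)).
  exact: measurable_mix.
apply: measurableT_comp; first exact: normr_measurable.
exact: measurable_funB.
Qed.

Let measurable_jump lam i : measurable (jump lam i).
Proof.
apply: measurableI; first exact: measurable_set_ltr.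
apply: measurable_set_ler => //; apply: measurable_funM => //.
apply: measurable_funX; exact: measurable_enorm_sub.
Qed.

Let integral_insert i :
  (\int[lebesgue_rV n]_v \int[lebesgue_measure]_t `|partial i u (insert i t v)|%:E
   = \int[lebesgue_rV N]_x `|partial i u x|%:E)%E.
Proof.
have mg : measurable_fun setT (fun x => `|partial i u x|%:E).
  apply/measurable_EFinP; apply: measurableT_comp; first exact: normr_measurable.
  exact: continuous_measurable_fun_rV.
have mins : measurable_fun setT
    (fun p : 'rV[R]_n * measurableTypeR R => insert i p.2 p.1).
  exact: measurable_insert.
rewrite -[LHS](@fubini_tonelli1 _ _ _ _ R (lebesgue_rV n) lebesgue_measure
  (fun p => `|partial i u (insert i p.2 p.1)|%:E)) //; last first.
  exact: (measurableT_comp mg mins).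
rewrite -[LHS](@ge0_integral_pushforward _ _ _ _ R _ mins _ setT
  (fun x => `|partial i u x|%:E)) //.
apply: (@eq_measure_integral _ _ _ _ (lebesgue_rV N)
  (measure_function_pushforward__canonical__measure_function_Measure
    (lebesgue_rV n \x lebesgue_measure)%E mins)) => A mA _.
exact: esym (lebesgue_rV_insert i mA).
Qed.

(** After the exchange of coordinates, the measure is the integral over [v] of the measures of the
    slices. Each slice is bounded by an integral of the partial derivative over a line, and
    integrating over [v] recovers the whole space. *)
Let measure_jump_le (lam : R) i : 0 < lam ->
  (mu (jump lam i) <= ((2 * (9 * 2 ^+ n)) * 2 ^+ n.+3 / lam)%:E *
    \int[lebesgue_rV N]_x (enorm (grad u x))%:E)%E.
Proof.
move=> lam0; rewrite /mu (lebesgue_rV_insert_pair i)//.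
set K := (_ / lam)%:E.
have K0 : (0 <= K)%E.
  by rewrite lee_fin; apply: divr_ge0; rewrite ?(ltW lam0)// !mulr_ge0// ?exprn_ge0.
have mA := measurable_insert_pair i measurableT (measurable_jump lam i).
rewrite setTI in mA.
have mg : measurable_fun setT
    (fun p : 'rV[R]_n * measurableTypeR R => `|partial i u (insert i p.2 p.1)|%:E).
  apply/measurable_EFinP; apply: measurableT_comp; first exact: normr_measurable.
  apply: (measurableT_comp (continuous_measurable_fun_rV (cdu (i := i)))).
  exact: measurable_insert.
have mF : measurable_fun setT (fun v : 'rV[R]_n =>
    \int[lebesgue_measure]_t `|partial i u (insert i t v)|%:E)%E.
  exact: (@measurable_fun_fubini_tonelli_F _ _ _ _ R lebesgue_measure
    (fun p => `|partial i u (insert i p.2 p.1)|%:E)).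
apply: (@le_trans _ _ (\int[lebesgue_rV n]_v
  (K * \int[lebesgue_measure]_t `|partial i u (insert i t v)|%:E))%E).
  apply: ge0_le_integral => //.
  - exact: measurable_fun_xsection.
  - exact: measurable_funeM.
  move=> v _; under eq_integral do rewrite -(derive1_insert i v).
  rewrite /=; apply: (@measure_slice_le_derive R n v (fun t => u (insert i t v))) => //.
  - by move=> t; apply: derivable_insert; exact: du.
  - rewrite (_ : derive1 _ = partial i u \o (fun t => insert i t v)).
      by move=> t; apply: continuous_comp; [exact: continuous_insert|exact: cdu].
    by apply/funext => t; rewrite /= derive1_insert.
  - exact: measurable_xsection.
  move=> [[a b] w]; rewrite /xsection/= inE => -[].
  (* The step becomes an increment of [u] between two points of the line through [v]. *)
  rewrite /step /=; have [-> ->] := mix_insert_pair i v a b w.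
  set D := `| _ | => D0 zD; split => //.
    apply: le_trans zD; rewrite ler_pM2l// lerXn2r ?nnegrE ?enorm_ge0//.
    apply: le_trans (normr_coord_le_enorm _ i).
    by rewrite !mxE/= unlift_none.
  move=> j; apply: le_trans zD; rewrite ler_pM2l// lerXn2r ?nnegrE ?enorm_ge0//.
  apply: le_trans (normr_coord_le_enorm _ (lift i j)).
  (* The exchange can only change the sign of this coordinate of the difference. *)
  rewrite !mxE liftK !mxE; case: ifP => _ //.
  by rewrite distrC.
rewrite ge0_integralZl//; last by move=> v _; apply: integral_ge0.
rewrite integral_insert; apply: lee_wpmul2l => //.
apply: ge0_le_integral => //.
- apply/measurable_EFinP; apply: measurableT_comp; first exact: normr_measurable.
  exact: continuous_measurable_fun_rV.
- apply/measurable_EFinP; apply: measurable_enorm => j.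
  by under eq_fun do rewrite mxE; exact: continuous_measurable_fun_rV.
move=> x _; rewrite lee_fin; apply: le_trans (normr_coord_le_enorm _ i).
by rewrite mxE.
Qed.

(** [N%:R ^+ 2] collects two losses: the threshold for a single step is [lam / N%:R], and there are
    [N] steps to sum over. *)
Lemma weak_type_gradient (lam : R) (E : set ('rV[R]_N * 'rV[R]_N)) :
  0 < lam -> measurable E ->
  (forall z, E z -> (u z.1 != u z.2) &&
     (lam * enorm (z.1 - z.2) ^+ N.+1 <= `|u z.1 - u z.2|)) ->
  (mu E <= ((2 * (9 * 2 ^+ n)) * 2 ^+ n.+3 * N%:R ^+ 2 / lam)%:E *
    \int[lebesgue_rV N]_x (enorm (grad u x))%:E)%E.
Proof.
move=> lam0 mE hE; set I := (\int[_]_x _)%E.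
have N0 : 0 < N%:R :> R by rewrite ltr0n.
have lamN : 0 < lam / N%:R by rewrite divr_gt0.
pose J (k : nat) := jump (lam / N%:R) (inord k).
have mJ k : measurable (J k) by exact: measurable_jump.
have EJ : E `<=` \big[setU/set0]_(k < N) J k.
  move=> [x y] /hE/andP[/= xy lxy].
  have [i hi] := exists_step x y.
  rewrite -bigcup_mkord; exists i => /=; first exact: ltn_ord.
  rewrite /J inord_val; split => /=.
    by apply: lt_le_trans hi; rewrite divr_gt0// normr_gt0 subr_eq0.
  by apply: le_trans hi; rewrite mulrAC ler_pM2r ?invr_gt0.
apply: (@le_trans _ _ (mu (\big[setU/set0]_(k < N) J k))).
  by apply: le_measure; rewrite ?inE//; exact: bigsetU_measurable.
apply: (@le_trans _ _ (\sum_(k < N) mu (J k))%E).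
  by apply: Boole_inequality => i _; exact: mJ.
apply: (@le_trans _ _ (\sum_(k < N)
    (((2 * (9 * 2 ^+ n)) * 2 ^+ n.+3 / (lam / N%:R))%:E * I)%E)%E).
  by apply: lee_sum => i _; exact: measure_jump_le.
rewrite sumr_const card_ord -[leLHS]/(enatmul _ N) -mule_natl muleA -EFinM.
rewrite (_ : N%:R * _ = (2 * (9 * 2 ^+ n)) * 2 ^+ n.+3 * N%:R ^+ 2 / lam)//.
by rewrite invf_div; ring.
Qed.

End weak_type_gradient.

(** * Hoelder's inequality for weak norms *)

Section weak_hoelder.
Context d (T : measurableType d) (R : realType) (mu : {measure set T -> \bar R}).

Lemma measure_gt0_eq0 (F : T -> R) : measurable_fun setT F ->
  (forall t : R, 0 < t -> mu [set x | t <= F x] = 0%E) ->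
  mu [set x | 0 < F x] = 0%E.
Proof.
move=> mF F0; apply/eqP; rewrite eq_le measure_ge0 andbT.
apply: (@measure_le_of_nondecreasing_cover _ _ _ _ _
  (fun k => [set x | k.+1%:R^-1 <= F x])).
- exact: measurable_set_ltr.
- by move=> k; exact: measurable_set_ler.
- move=> k x /=; apply: le_trans.
  by rewrite lef_pV2 ?posrE// ler_nat.
- move=> x /= Fx; exists (Num.truncn (F x)^-1) => //=.
  by rewrite invf_ple ?posrE// ltW// truncnS_gt.
- by move=> k; rewrite F0// invr_gt0.
Qed.

Variables (F1 F2 : T -> R) (a b : \bar R) (q theta p : R).
Hypothesis mF1 : measurable_fun setT F1.
Hypothesis mF2 : measurable_fun setT F2.
Hypothesis F1_ge0 : forall x, 0 <= F1 x.
Hypothesis F2_ge0 : forall x, 0 <= F2 x.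
Hypothesis q0 : 0 < q.
Hypothesis theta01 : 0 < theta < 1.
Hypothesis p1 : 1 <= p.
Hypothesis pE : p^-1 = theta / q + (1 - theta).
Hypothesis F1a : forall t : R, 0 < t ->
  ((t `^ q)%:E * mu [set x | (t <= F1 x)%R] <= a)%E.
Hypothesis F2b : forall t : R, 0 < t ->
  (t%:E * mu [set x | (t <= F2 x)%R] <= b)%E.

Let theta0 : 0 < theta. Proof. by case/andP: theta01. Qed.
Let theta1 : 0 < 1 - theta. Proof. by rewrite subr_gt0; case/andP: theta01. Qed.
Let p0 : 0 < p. Proof. exact: lt_le_trans p1. Qed.
Let a0 : (0 <= a)%E.
Proof.
by apply: le_trans (F1a ltr01); rewrite mule_ge0// lee_fin powR_ge0.
Qed.
Let b0 : (0 <= b)%E. Proof. by apply: le_trans (F2b ltr01); rewrite mule_ge0. Qed.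

Let F x := F1 x `^ theta * F2 x `^ (1 - theta).

Let measurable_F : measurable_fun setT F.
Proof.
apply: measurable_funM.
  exact: (measurableT_comp (measurable_powR theta) mF1).
exact: (measurableT_comp (measurable_powR (1 - theta)) mF2).
Qed.

(** A vanishing bound makes the corresponding factor vanish almost everywhere, whereas a positive
    product needs two positive factors. The case is treated apart because the levels [m1] and [m2]
    of the main argument must be positive. *)
Let measure_F_eq0 (lam : R) : 0 < lam -> (a == 0)%E || (b == 0)%E ->
  mu [set x | lam <= F x] = 0%E.
Proof.
move=> lam0 /orP ab; apply/eqP; rewrite eq_le measure_ge0 andbT.
have mS : measurable [set x | lam <= F x] by exact: measurable_set_ler.
case: ab => /eqP ab0.
  rewrite -(@measure_gt0_eq0 F1) => [||t t0]; last 2 first.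
  - exact: mF1.
  - have := F1a t0; rewrite ab0 pmule_rle0 ?lte_fin ?powR_gt0// => h.
    by apply/eqP; rewrite eq_le h measure_ge0.
  apply: le_measure; rewrite ?inE//; first exact: measurable_set_ltr.
  move=> x /= Fx; rewrite lt_neqAle F1_ge0 andbT; apply/eqP => F10.
  move: Fx; rewrite /F -F10 powR0 ?gt_eqF// mul0r => /(lt_le_trans lam0).
  by rewrite ltxx.
rewrite -(@measure_gt0_eq0 F2) => [||t t0]; last 2 first.
- exact: mF2.
- have := F2b t0; rewrite ab0 pmule_rle0 ?lte_fin// => h.
  by apply/eqP; rewrite eq_le h measure_ge0.
apply: le_measure; rewrite ?inE//; first exact: measurable_set_ltr.
move=> x /= Fx; rewrite lt_neqAle F2_ge0 andbT; apply/eqP => F20.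
move: Fx; rewrite /F -F20 powR0 ?gt_eqF// mulr0 => /(lt_le_trans lam0).
by rewrite ltxx.
Qed.

(** [a] plays the role of the q-th power of the weak L^q norm of [F1], and [b] that of the weak L^1
    norm of [F2]. If the levels [m1] and [m2], raised to the powers theta and 1 - theta, have
    product [lam], then [F] reaches [lam] only where [m1 <= F1] or [m2 <= F2]. *)
Lemma weak_hoelder (lam : R) : 0 < lam ->
  ((lam `^ p)%:E * mu [set x | (lam <= F1 x `^ theta * F2 x `^ (1 - theta))%R] <=
   (2%:E * a `^ (theta / q) * b `^ (1 - theta)) `^ p)%E.
Proof.
move=> lam0; have tq0 : 0 < theta / q by rewrite divr_gt0.
have [ab0|] := boolP ((a == 0)%E || (b == 0)%E).
  by rewrite measure_F_eq0// mule0 poweR_ge0.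
rewrite negb_or => /andP[aN0 bN0].
have a_gt0 : (0 < a)%E by rewrite lt_neqAle eq_sym aN0.
have b_gt0 : (0 < b)%E by rewrite lt_neqAle eq_sym bN0.
(* If one bound is infinite, so is the right-hand side, the other bound being positive. *)
have [aoo|afin] := eqVneq a +oo%E.
  rewrite aoo poweRyr ?gt_eqF// gt0_muley ?lte_fin// gt0_mulye ?poweR_gt0//.
  by rewrite poweRyr ?gt_eqF// leey.
have [boo|bfin] := eqVneq b +oo%E.
  rewrite boo poweRyr ?gt_eqF// gt0_muley ?mule_gt0 ?poweR_gt0//.
  by rewrite poweRyr ?gt_eqF// leey.
have aE : a = (fine a)%:E by rewrite fineK// ge0_fin_numE// ltey.
have bE : b = (fine b)%:E by rewrite fineK// ge0_fin_numE// ltey.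
move: a_gt0 b_gt0 F1a F2b; rewrite aE bE !lte_fin.
move: (fine a) (fine b) => {aE bE} r s r0 s0 F1r F2s.
rewrite !poweR_EFin.
set X := r `^ (theta / q) * s `^ (1 - theta).
have X0 : 0 < X by rewrite mulr_gt0 ?powR_gt0.
pose t := (X / lam) `^ p.
have t0 : 0 < t by rewrite powR_gt0// divr_gt0.
(* the two levels at which both weak-type bounds equal t *)
pose m1 := (r / t) `^ q^-1; pose m2 := s / t.
have m10 : 0 < m1 by rewrite powR_gt0// divr_gt0.
have m20 : 0 < m2 by rewrite divr_gt0.
have lamE : lam = m1 `^ theta * m2 `^ (1 - theta).
  (* By [pE], the powers of [t] combine to t^(-1/p), which is [lam / X]. *)
  rewrite /m1 /m2 -powRrM [q^-1 * _]mulrC.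
  rewrite !powRM ?invr_ge0 ?(ltW r0) ?(ltW s0) ?(ltW t0)//.
  rewrite mulrACA -/X -powRD; last by rewrite -pE invr_eq0 (gt_eqF p0).
  have tp : t `^ p^-1 = X / lam.
    by rewrite /t -powRrM mulfV ?gt_eqF// powRr1// divr_ge0// ltW.
  have -> : t^-1 `^ (theta / q + (1 - theta)) = lam / X.
    rewrite -pE -(powR_inv1 (ltW t0)) powRAC tp powR_inv1 ?invf_div//.
    by rewrite divr_ge0// ltW.
  by rewrite mulrC divfK// gt_eqF.
have m1q : m1 `^ q = r / t.
  by rewrite -powRrM mulVf ?gt_eqF// powRr1// divr_ge0 ?(ltW r0) ?(ltW t0).
have mS1 : measurable [set x | m1 <= F1 x] by exact: measurable_set_ler.
have mS2 : measurable [set x | m2 <= F2 x] by exact: measurable_set_ler.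
have muF1 : (mu [set x | (m1 <= F1 x)%R] <= t%:E)%E.
  have := F1r _ m10; rewrite m1q -lee_pdivlMl ?divr_gt0// -EFinM.
  by rewrite invf_div divfK// gt_eqF.
have muF2 : (mu [set x | (m2 <= F2 x)%R] <= t%:E)%E.
  have := F2s _ m20; rewrite -lee_pdivlMl ?divr_gt0// -EFinM.
  by rewrite invf_div divfK// gt_eqF.
have muF : (mu [set x | (lam <= F x)%R] <= (2 * t)%:E)%E.
  rewrite mulr_natl mulr2n EFinD; apply: le_trans (leeD muF1 muF2).
  apply: le_trans (measureU2 mu mS1 mS2).
  apply: le_measure; rewrite ?inE//; first exact: measurable_set_ler.
    exact: measurableU.
  move=> x /= Fx; have [|x1] := leP m1 (F1 x); first by left.
  right; rewrite leNgt; apply/negP => x2; move: Fx; apply/negP; rewrite -ltNge.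
  by rewrite lamE ltr_pM ?powR_ge0// gt0_ltr_powR// ?nnegrE// ltW.
apply: (@le_trans _ _ ((lam `^ p)%:E * (2 * t)%:E)%E).
  by apply: lee_wpmul2l => //; rewrite lee_fin powR_ge0.
rewrite -EFinM lee_fin mulrCA -powRM ?divr_ge0 ?(ltW lam0) ?(ltW X0)//.
rewrite [lam * _]mulrC divfK ?gt_eqF// -mulrA -/X [leRHS]powRM ?(ltW X0)//.
(* What remains is 2 <= 2^p, which holds as [1 <= p]. *)
rewrite ler_wpM2r ?powR_ge0// -[leLHS]powRr1//.
by apply: ler_powR => //; rewrite ler1n.
Qed.

End weak_hoelder.

(** * Chebyshev's inequality and the Marcinkiewicz quasi-norm *)

Lemma powR_measure_le_integral d (T : measurableType d) (R : realType)
    (mu : {measure set T -> \bar R}) (F : T -> R) (q t : R) :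
  measurable_fun setT F -> (forall x, 0 <= F x) -> 0 < q -> 0 < t ->
  ((t `^ q)%:E * mu [set x | (t <= F x)%R] <= \int[mu]_x (F x `^ q)%:E)%E.
Proof.
move=> mF F0 q0 t0; set S := [set x | _].
have mS : measurable S by exact: measurable_set_ler.
have mFq : measurable_fun setT (fun x => (F x `^ q)%:E).
  by apply/measurable_EFinP; exact: (measurableT_comp (measurable_powR q) mF).
rewrite -(integral_cst _ mS).
apply: (@le_trans _ _ (\int[mu]_(x in S) (F x `^ q)%:E)%E).
  apply: ge0_le_integral => //.
  - by move=> x _; rewrite lee_fin powR_ge0.
  - exact: measurable_funTS.
  - by move=> x Sx; rewrite lee_fin ge0_ler_powR ?nnegrE// ltW.
by apply: ge0_subset_integral => // x _; rewrite lee_fin powR_ge0.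
Qed.

Lemma marcinkiewicz_le d (T : measurableType d) (R : realType)
    (mu : {measure set T -> \bar R}) (p : R) (f : T -> R) (M : \bar R) :
  0 < p -> (0 <= M)%E ->
  (forall t : R, 0 < t ->
    ((t `^ p)%:E * mu [set x | (t <= `|f x|)%R] <= M `^ p)%E) ->
  (marcinkiewicz mu p f <= M)%E.
Proof.
move=> p0 M0 tM; rewrite /marcinkiewicz.
rewrite -[leRHS]poweRe1// -(mulfV (lt0r_neq0 p0)) poweRrM.
apply: gt0_ler_poweR; rewrite ?invr_ge0 ?(ltW p0)//.
(* Monotonicity of the root asks for a nonnegative supremum; the level 1 provides a nonnegative
   member. *)
- rewrite in_itv/= leey andbT.
  apply: (@le_trans _ _ ((1 `^ p)%:E * mu [set x | (1 <= `|f x|)%R])%E).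
    by rewrite mule_ge0// lee_fin powR_ge0.
  by apply: ereal_sup_ubound; exists 1 => //; exact: ltr01.
- by rewrite in_itv/= leey andbT poweR_ge0.
by apply: ge_ereal_sup => _ [t /= t0 <-]; exact: tM.
Qed.

(** * Interpolation of difference quotients *)

Section diff_quotient.
Context {R : realType} {N : nat}.
Variable u : 'rV[R]_N -> R.
Hypothesis cu : continuous u.

Definition diff_quotient (alpha : R) (z : 'rV[R]_N * 'rV[R]_N) : R :=
  `|u z.1 - u z.2| / enorm (z.1 - z.2) `^ alpha.

Lemma diff_quotient_ge0 alpha z : 0 <= diff_quotient alpha z.
Proof. by rewrite divr_ge0// powR_ge0. Qed.

Lemma measurable_diff_quotient alpha : measurable_fun setT (diff_quotient alpha).
Proof.
rewrite /diff_quotient; under eq_fun do rewrite -powRN.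
apply: measurable_funM.
  apply: measurableT_comp; first exact: normr_measurable.
  apply: measurable_funB.
    exact: (measurableT_comp (continuous_measurable_fun_rV cu) measurable_fst).
  exact: (measurableT_comp (continuous_measurable_fun_rV cu) measurable_snd).
exact: (measurableT_comp (measurable_powR (- alpha)) measurable_enorm_sub).
Qed.

Lemma diff_quotient_interpolation alpha beta theta z : 0 < theta < 1 ->
  0 < alpha -> 0 < beta ->
  diff_quotient (theta * alpha + (1 - theta) * beta) z =
  diff_quotient alpha z `^ theta * diff_quotient beta z `^ (1 - theta).
Proof.
move=> /andP[t0 t1] a0 b0; have t1' : 0 < 1 - theta by rewrite subr_gt0.
rewrite /diff_quotient -!powRN.
move: (`|u z.1 - u z.2|) (normr_ge0 (u z.1 - u z.2)) => D D0.
rewrite !powRM ?powR_ge0// mulrACA -powRD; last first.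
  by rewrite addrC subrK oner_eq0.
(* On base 0, exponents may be added only if their sum is nonzero; the positivity of [alpha] and
   [beta] ensures this, so the identity includes the diagonal. *)
rewrite [theta + _]addrC subrK powRr1// -!powRrM -powRD; last first.
  by rewrite !mulNr -opprD oppr_eq0 gt_eqF// addr_gt0// mulr_gt0.
by congr (_ * _ `^ _); ring.
Qed.

End diff_quotient.

(** * The interpolation inequality *)

Local Open Scope ereal_scope.

Theorem mainTheorem7 (R : realType) (N : nat) (hN : (1 <= N)%N) :
  exists C : R, forall p1 theta s1 s p : R,
    (1 < p1)%R -> (0 < theta < 1)%R -> (0 < s1 < 1)%R -> (1 <= s1 * p1)%R ->
    s = (theta * s1 + (1 - theta))%R ->
    (p^-1)%R = (theta / p1 + (1 - theta))%R ->
    forall u : 'rV[R]_N -> R, Cc_infty u ->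
      marcinkiewicz (lebesgue_rV N \x lebesgue_rV N) p
        (fun z : 'rV[R]_N * 'rV[R]_N =>
           (u z.1 - u z.2) / enorm (z.1 - z.2) `^ (N%:R / p + s))%R
      <= C%:E * gagliardo s1 p1 u `^ theta
           * 'N[lebesgue_rV N]_1[EFin \o (fun x => enorm (grad u x))] `^ (1 - theta).
Proof.
case: N hN => // n _; set N := n.+1.
pose C1 : R := ((2 * (9 * 2 ^+ n)) * 2 ^+ n.+3 * N%:R ^+ 2)%R.
have C10 : (0 <= C1)%R.
  by rewrite /C1 mulr_ge0 ?exprn_ge0// mulr_ge0 ?exprn_ge0// mulr_ge0//
    mulr_ge0 ?exprn_ge0.
(* The 2 comes from [weak_hoelder]; [1 + C1] bounds the power 1 - theta of [C1] whatever theta is,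
   so the constant depends on [N] only. *)
exists (2 * (1 + C1))%R => p1 theta s1 s p p1_gt1 theta01 /andP[s10 _] _ sE pE.
move=> u [su _].
have /andP[theta0 theta1] := theta01.
have theta1' : (0 < 1 - theta)%R by rewrite subr_gt0.
have p10 : (0 < p1)%R by exact: lt_trans p1_gt1.
have pinv0 : (0 < p^-1)%R by rewrite pE addr_gt0// divr_gt0.
have p0 : (0 < p)%R by rewrite -invr_gt0.
have p_ge1 : (1 <= p)%R.
  rewrite -[leRHS]invrK invf_ge1// pE -lerBrDr opprB addrCA subrr addr0.
  by rewrite ler_pdivrMr// ler_peMr// ltW.
have cu : continuous u by have [] := su [::].
have du i x : derivable u x (delta_mx ord0 i) by have [_] := su [::]; exact.
have cdu i : continuous (partial i u) by have [] := su [:: i].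
set mu := (_ \x _)%E; set V := 'N[_]_1[_].
have VE : V = \int[lebesgue_rV N]_x (enorm (grad u x))%:E.
  by rewrite /V Lnorm1; apply: eq_integral => x _; rewrite /= ger0_norm ?enorm_ge0.
have V0 : 0 <= V by rewrite VE integral_ge0// => x _; rewrite lee_fin enorm_ge0.
(* [G] is the p1-th power of the seminorm, because (N / p1 + s1) p1 = N + s1 p1. *)
pose G := \int[mu]_z (diff_quotient u (N%:R / p1 + s1) z `^ p1)%:E.
have GE : gagliardo s1 p1 u = G `^ p1^-1.
  rewrite /gagliardo; congr (_ `^ _); apply: eq_integral => z _; congr EFin.
  rewrite /diff_quotient -!powRN [RHS]powRM ?powR_ge0// -powRrM; congr (_ * _ `^ _)%R.
  by rewrite mulNr mulrDl divfK// gt_eqF.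
have alpha0 : (0 < N%:R / p1 + s1)%R by rewrite addr_gt0// divr_gt0.
have F1G (t : R) : (0 < t)%R ->
    (t `^ p1)%:E * mu [set z | (t <= diff_quotient u (N%:R / p1 + s1) z)%R] <= G.
  move=> t0; apply: powR_measure_le_integral => //.
    exact: measurable_diff_quotient.
  by move=> z; exact: diff_quotient_ge0.
have F2V (t : R) : (0 < t)%R ->
    t%:E * mu [set z | (t <= diff_quotient u N.+1%:R z)%R] <= C1%:E * V.
  move=> t0; rewrite -lee_pdivlMl// muleA -EFinM mulrC VE.
  have mF2 : measurable_fun setT (diff_quotient u N.+1%:R).
    exact: measurable_diff_quotient.
  apply: (weak_type_gradient cu du cdu t0); first exact: measurable_set_ler.
  move=> z /=; rewrite /diff_quotient powR_mulrn ?enorm_ge0// => tz.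
  (* The quotient is 0 when the two values of [u] agree, and also when the distance is 0, the
     inverse of 0 being 0; neither is compatible with a level [t > 0]. *)
  have [uz|uz] := eqVneq (u z.1) (u z.2).
    by move: tz; rewrite uz subrr normr0 mul0r leNgt t0.
  rewrite /=; have [e0|e0] := eqVneq (enorm (z.1 - z.2)) 0%R.
    by move: tz; rewrite e0 expr0n/= invr0 mulr0 leNgt t0.
  by rewrite -ler_pdivlMr// exprn_gt0// lt_neqAle eq_sym e0 enorm_ge0.
have fE z : (`|(u z.1 - u z.2) / enorm (z.1 - z.2) `^ (N%:R / p + s)| =
    diff_quotient u (N%:R / p1 + s1) z `^ theta *
    diff_quotient u N.+1%:R z `^ (1 - theta))%R.
  rewrite normrM normfV (ger0_norm (powR_ge0 _ _)) -diff_quotient_interpolation//.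
  rewrite /diff_quotient; congr (_ / _ `^ _)%R; rewrite pE sE -addn1 natrD; ring.
apply: (@le_trans _ _ (2%:E * G `^ (theta / p1) * (C1%:E * V) `^ (1 - theta))).
  apply: marcinkiewicz_le => //; first by rewrite mule_ge0 ?mule_ge0 ?poweR_ge0.
  move=> t t0; under eq_set do rewrite fE.
  apply: weak_hoelder => //; try exact: measurable_diff_quotient.
  - by move=> z; exact: diff_quotient_ge0.
  - by move=> z; exact: diff_quotient_ge0.
rewrite GE -poweRrM [(p1^-1 * _)%R]mulrC poweRM// (EFinM 2 (1 + C1)).
rewrite -!muleA; apply: lee_wpmul2l => //.
rewrite [leRHS]muleCA; apply: lee_wpmul2l; first exact: poweR_ge0.
apply: lee_wpmul2r; first exact: poweR_ge0.
rewrite poweR_EFin lee_fin.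
apply: (@le_trans _ _ ((1 + C1) `^ (1 - theta))%R).
  by rewrite ge0_ler_powR ?nnegrE ?(ltW theta1') ?lerDr// addr_ge0.
rewrite -[leRHS]powRr1 ?addr_ge0//.
by apply: ler_powR; [rewrite lerDl|rewrite lerBlDr lerDl ltW].
Qed.
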